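(* Let $\mathcal{X}\subset L^0$ be a solid space containing the constants and let $\psi:\mathcal{X}\to\mathbb{R}$ be a finite-valued monotone convex function satisfying the Fatou property on $\mathcal{X}$. Put $\psi_\infty^*(Z)=\sup_{X\in L^\infty}(\mathbb{E}[XZ]-\psi(X))$ for $Z\in L^1$ and $\mathrm{dom}\,\psi_\infty^*=\{Z\in L^1:\psi_\infty^*(Z)<\infty\}$. Then the following are equivalent: (1) $\psi$ has the Lebesgue property on $\mathcal{X}$; (2) for all $X\in\mathcal{X}$ and $c>0$, the set $\{XZ:\ Z\in L^1,\ \psi_\infty^*(Z)\le c\}$ is uniformly integrable; (3) the supremum $\sup_{Z\in\mathrm{dom}\,\psi_\infty^*}(\mathbb{E}[XZ]-\psi_\infty^*(Z))$ is finite and attained for all $X\in\mathcal{X}$; (4) $\psi(X)=\max_{Z\in\mathrm{dom}\,\psi_\infty^*}(\mathbb{E}[XZ]-\psi_\infty^*(Z))$ for all $X\in\mathcal{X}$.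
   Context: $(\Omega,\mathcal{F},\mathbb{P})$ is a probability space; $L^0$ is the space of finite real random variables modulo $\mathbb{P}$-a.s. equality with the a.s. pointwise order; $L^p=L^p(\Omega,\mathcal F,\mathbb P)$; $\mathbb{E}$ is expectation under $\mathbb{P}$; uniform integrability is with respect to $\mathbb{P}$. A solid space is a linear subspace $\mathcal{X}\subset L^0$ such that $|X|\le|Y|$ a.s. and $Y\in\mathcal{X}$ imply $X\in\mathcal{X}$. A monotone convex function on $\mathcal{X}$ is a proper convex function $\psi:\mathcal{X}\to(-\infty,\infty]$ with $X\le Y$ a.s. $\Rightarrow\psi(X)\le\psi(Y)$. $\psi$ has the Fatou property (resp. the Lebesgue property) on $\mathcal{X}$ if for every sequence $(X_n)\subset\mathcal{X}$ such that there is $Y\in\mathcal{X}$, $Y\ge0$, with $|X_n|\le Y$ for all $n$ and $X_n\to X$ a.s., one has $\psi(X)\le\liminf_n\psi(X_n)$ (resp. $\psi(X)=\lim_n\psi(X_n)$). Under the hypotheses, $XZ\in L^1$ for all $X\in\mathcal{X}$ and $Z\in\mathrm{dom}\,\psi_\infty^*$, so the expectations are well defined. ''max'' means that the supremum is attained. *)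

(* Defs.v *)
From HB Require Import structures.
From mathcomp Require Import all_boot all_order all_algebra.
From mathcomp Require Import all_classical all_reals all_analysis.

Set Implicit Arguments.
Unset Strict Implicit.
Unset Printing Implicit Defensive.

Import Order.TTheory GRing.Theory Num.Theory.
Import numFieldNormedType.Exports.

Local Open Scope classical_set_scope.
Local Open Scope ring_scope.

(* L^0 is handled through representatives {RV P >-> R}, with equality, order
   and convergence taken P-almost surely. Solidity makes a set of
   representatives saturated for a.s. equality (solid_space_ae) and
   monotonicity makes a function on it invariant (monotone_ae), so these are
   exactly the solid subspaces of the quotient and the monotone functions on
   them. A function on a solid space is a function on {RV P >-> R} whose values
   outside of the space are ignored. *)
Section solid_spaces.
Context d (T : measurableType d) (R : realType) (P : probability T R).
Implicit Types (E : set {RV P >-> R}) (psi : {RV P >-> R} -> R).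
Implicit Types (X Y Z : {RV P >-> R}).

Definition linear_subspace E :=
  E (cst 0) /\
  forall (a b : R) X Y, E X -> E Y -> E (a *: X + b *: Y : {mfun T >-> R}).

Definition solid_space E :=
  linear_subspace E /\
  forall X Y, (\forall w \ae P, `|X w| <= `|Y w|) -> E Y -> E X.

Definition contains_constants E := forall c : R, E (cst c).

Definition ae_monotone E psi :=
  forall X Y, E X -> E Y -> (\forall w \ae P, X w <= Y w) -> psi X <= psi Y.

Definition monotone_convex E psi :=
  convex_function (E : set {mfun T >-> R}) psi /\ ae_monotone E psi.

Definition dominated_ae_cvg E (X_ : nat -> {RV P >-> R}) X :=
  [/\ forall n, E (X_ n),
      exists Y, [/\ E Y, \forall w \ae P, 0 <= Y w &
                    forall n, \forall w \ae P, `|X_ n w| <= Y w] &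
      \forall w \ae P, X_ n w @[n --> \oo] --> X w].

Definition fatou_property E psi := forall (X_ : nat -> {RV P >-> R}) X,
  dominated_ae_cvg E X_ X ->
  ((psi X)%:E <= limn_einf (fun n => (psi (X_ n))%:E))%E.

Definition lebesgue_property E psi := forall (X_ : nat -> {RV P >-> R}) X,
  dominated_ae_cvg E X_ X ->
  psi (X_ n) @[n --> \oo] --> psi X.

Definition L1 : set {RV P >-> R} := [set Z | (Z : T -> R) \in Lfun P 1%E].

Definition Loo : set {RV P >-> R} := [set X | (X : T -> R) \in Lfun P +oo%E].

Definition conj_Loo psi Z : \bar R :=
  ereal_sup [set ('E_P[X \* Z] - (psi X)%:E)%E | X in Loo].

Definition dom_conj_Loo psi : set {RV P >-> R} :=
  [set Z | L1 Z /\ (conj_Loo psi Z < +oo)%E].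

(* E[XZ] is finite when psi is finite and monotone convex on a solid space
   containing the constants, X lies in that space and Z in dom_conj_Loo psi;
   conj_Loo psi Z is never -oo, so the difference below is not degenerate. *)
Definition dual_value psi X Z : \bar R := ('E_P[X \* Z] - conj_Loo psi Z)%E.

Definition dual_sup psi X : \bar R :=
  ereal_sup [set dual_value psi X Z | Z in dom_conj_Loo psi].

Definition dual_attained psi X :=
  exists2 Z, dom_conj_Loo psi Z & dual_value psi X Z = dual_sup psi X.

(* lim_(K -> +oo) sup_(V in S) E[|V| 1_(|V| > K)] = 0, the supremum of the
   empty family being 0. *)
Definition uniformly_integrable (S : set (T -> R)) :=
  forall e : R, 0 < e -> \forall K \near +oo, forall V : T -> R, S V ->
  (\int[P]_(w in [set w | (K < `|V w|)%R]) `|V w|%:E <= e%:E)%E.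

Lemma solid_space_ae E X Y : solid_space E -> X = Y %[ae P] -> E X -> E Y.
Proof.
move=> [_ sE] XY; apply: sE; move: XY; apply: filterS => w /= ->//.
Qed.

Lemma monotone_ae E psi X Y : solid_space E -> ae_monotone E psi ->
  X = Y %[ae P] -> E X -> psi X = psi Y.
Proof.
move=> sE mpsi XY EX; have EY := solid_space_ae sE XY EX.
by apply/eqP; rewrite eq_le !mpsi//; move: XY; apply: filterS => w /= ->.
Qed.

End solid_spaces.

Arguments solid_space {d T R} P E.
Arguments contains_constants {d T R} P E.
Arguments monotone_convex {d T R} P E psi.
Arguments fatou_property {d T R} P E psi.
Arguments lebesgue_property {d T R} P E psi.
Arguments L1 {d T R} P.
Arguments conj_Loo {d T R} P psi Z.
Arguments dual_sup {d T R} P psi X.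
Arguments dual_attained {d T R} P psi X.

(* Main.v *)
Require Import Defs.
From HB Require Import structures.
From mathcomp Require Import all_boot all_order all_algebra.
From mathcomp Require Import all_classical all_reals all_analysis.
From mathcomp Require Import measurable_realfun ess_sup_inf lra ring.

Set Implicit Arguments.
Unset Strict Implicit.
Unset Printing Implicit Defensive.

Import Order.TTheory GRing.Theory Num.Theory.
Import numFieldNormedType.Exports.

Local Open Scope classical_set_scope.
Local Open Scope ring_scope.

(** Why the four conditions are equivalent.

    Write [alpha Z] for the conjugate of [psi] over the bounded random variables.
    Its finiteness forces [Z >= 0], and by truncation
    [E[V Z] <= psi V + alpha Z] for [V >= 0] in the space (lemma [fenchel]).

    From the Lebesgue property to uniform integrability: if [alpha Z <= c] then
    [E[|X| Z 1_A] <= (psi (t |X| 1_A) + c) / t], which is small when [t] is large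
    and then [P A] is small ([sublevel_uniformly_integrable], stated for a general
    bound in place of [psi]).

    From the Lebesgue property to the attained equality: a subgradient of [psi] at
    [X], given by the Hahn-Banach theorem ([convex_subgradient]), is positive and
    order continuous, hence of the form [E[. Z]] by the Radon-Nikodym theorem
    ([order_continuous_representation]); this [Z] attains the supremum
    ([lebesgue_dual_attained]).

    From uniform integrability back to the Lebesgue property, the Fatou property
    enters through the duality on bounded random variables: if [a < psi X], some
    [Z] has [a <= E[X Z] - alpha Z] ([bounded_duality]). Rather than going through
    the Krein-Smulian theorem, one builds a convex penalty [E[Phi Y]], with [Phi]
    growing as fast as needed, such that [psi (X - Y) + E[Phi Y] > a] for every
    bounded [Y >= 0]. The slopes of [Phi] are chosen one height after the other; a
    failure at one height would give decreasing bounded convex sets, whose common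
    point ([decreasing_convex_common_point]) contradicts the previous height. A
    subgradient of the infimal convolution of [psi] and the penalty is countably
    additive since the penalty is. With this duality, uniform integrability gives
    [psi (W_n) -> psi 0] for dominated [W_n -> 0] with [W_n >= 0], and convexity
    gives the Lebesgue property.

    From attained suprema to uniform integrability, a form of James' theorem is
    needed. The dual supremum [S] is convex and monotone, and by the first argument
    it is enough that [S (W_n)] falls to [S 0] when [W_n] decreases to [0]. If it
    does not, Simons' argument gives a series [z = sum_n 2^(-n-1) W_(k_n)] at which
    any maximizing [Z] has [E[W_(k_n) Z]] bounded away from [0]
    ([simons_series]), against dominated convergence. *)

(** * Subgradients of convex functions *)

Section subgradient.
Context {R : realType} {V : lmodType R}.
Implicit Types (E : set V) (h q : V -> R) (x y : V).

Definition vector_subspace E :=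
  E 0 /\ forall (a b : R) x y, E x -> E y -> E (a *: x + b *: y).

Definition convex_on E h := forall x y (t : R), E x -> E y -> 0 <= t <= 1 ->
  h (t *: x + (1 - t) *: y) <= t * h x + (1 - t) * h y.

Definition sublinear_on E q :=
  (forall (a : R) x, 0 < a -> E x -> q (a *: x) <= a * q x) /\
  (forall x y, E x -> E y -> q (x + y) <= q x + q y).

Definition linear_on E (phi : V -> R) := forall (a b : R) x y, E x -> E y ->
  phi (a *: x + b *: y) = a * phi x + b * phi y.

Lemma vector_subspaceD E x y : vector_subspace E -> E x -> E y -> E (x + y).
Proof. by move=> [_ sE] Ex Ey; have := sE 1 1 _ _ Ex Ey; rewrite !scale1r. Qed.

Lemma vector_subspaceZ E (a : R) x : vector_subspace E -> E x -> E (a *: x).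
Proof.
by move=> [E0 sE] Ex; have := sE a 0 _ _ Ex E0; rewrite scaler0 addr0.
Qed.

Lemma vector_subspaceN E x : vector_subspace E -> E x -> E (- x).
Proof. by move=> sE Ex; rewrite -scaleN1r; exact: vector_subspaceZ. Qed.

Lemma vector_subspaceB E x y : vector_subspace E -> E x -> E y -> E (x - y).
Proof.
by move=> sE Ex Ey; apply: vector_subspaceD => //; exact: vector_subspaceN.
Qed.

Lemma conv_translate (s : R) x u v :
  s *: (x + u) + (1 - s) *: (x + v) = x + (s *: u + (1 - s) *: v).
Proof.
rewrite !scalerDr addrACA -scalerDl; congr (_ + _).
by rewrite addrC subrK scale1r.
Qed.

Section fixed_subspace.
Variables (E : set V) (sE : vector_subspace E).

Lemma sublinear0 q : sublinear_on E q -> q 0 = 0.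
Proof.
case=> hq _; have E0 := sE.1.
have := hq 2%:R 0 ltac:(lra) E0.
have := hq 2%:R^-1 0 ltac:(lra) E0.
rewrite !scaler0; lra.
Qed.

Lemma sublinearN q x : sublinear_on E q -> E x -> - q (- x) <= q x.
Proof.
move=> hq Ex; have := hq.2 _ _ Ex (vector_subspaceN sE Ex).
by rewrite subrr (sublinear0 hq); lra.
Qed.

Lemma sublinearZ q (a : R) x : sublinear_on E q -> 0 < a -> E x ->
  q (a *: x) = a * q x.
Proof.
move=> hq a0 Ex; apply/eqP; rewrite eq_le hq.1//=.
have a'0 : 0 < a^-1 by rewrite invr_gt0.
have := hq.1 _ _ a'0 (vector_subspaceZ a sE Ex).
by rewrite scalerA mulVf ?gt_eqF// scale1r mulrC ler_pdivlMr// mulrC.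
Qed.

(** Zorn's lemma is applied to functions that vanish off [E]: on these the
    pointwise order is antisymmetric. The infimum of a chain is finite because
    [- p (- x)] bounds every sublinear function below [p], and it is subadditive
    because of two members of a chain one is below the other. *)
Let T (p : V -> R) := {q : V -> R | sublinear_on E q /\
  (forall x, E x -> q x <= p x) /\ (forall x, ~ E x -> q x = 0)}.
Let below (p : V -> R) (q q' : T p) :=
  `[< forall x, sval q' x <= sval q x >].

Let T_lb p (q : T p) x : E x -> - p (- x) <= sval q x.
Proof.
case: q => q [sq [qp q0]] Ex /=; apply: le_trans (sublinearN sq Ex).
by rewrite lerN2 qp//; exact: vector_subspaceN.
Qed.

Lemma minimal_sublinear p : sublinear_on E p -> exists2 q : V -> R,
  sublinear_on E q /\ (forall x, E x -> q x <= p x) &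
  forall q', sublinear_on E q' -> (forall x, E x -> q' x <= q x) ->
    forall x, E x -> q' x = q x.
Proof.
move=> sp.
pose restr q := fun x => if pselect (E x) then q x else 0.
have restrE q x : E x -> restr q x = q x by rewrite /restr; case: pselect.
have restr_sub q : sublinear_on E q -> sublinear_on E (restr q).
  move=> sq; split => [a x a0 Ex|x y Ex Ey].
    by rewrite !restrE//; [exact: sq.1|exact: vector_subspaceZ].
  by rewrite !restrE//; [exact: sq.2|exact: vector_subspaceD].
have restrT q (sq : sublinear_on E q) (qp : forall x, E x -> q x <= p x) :
    sublinear_on E (restr q) /\ (forall x, E x -> restr q x <= p x) /\
    (forall x, ~ E x -> restr q x = 0).
  split; first exact: restr_sub.
  by split => [x Ex|x nEx]; [rewrite restrE// qp|rewrite /restr; case: pselect].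
pose mkT q sq qp : T p := exist _ (restr q) (restrT q sq qp).
have [||||[q [sq [qp q0]]] qmin] := @Zorn (T p) (@below p).
- by move=> t; apply/asboolP.
- move=> r s t /asboolP rs /asboolP st; apply/asboolP => x.
  exact: le_trans (st x) (rs x).
- move=> [s Hs] [t Ht] /asboolP/= st /asboolP/= ts.
  apply: eq_exist => /=; apply/funext => x; apply/eqP.
  by rewrite eq_le st ts.
- move=> A totA; have [[q1 Aq1]|A0] := pselect (A !=set0); last first.
    exists (mkT _ sp (fun _ _ => lexx _)) => s As.
    by exfalso; apply: A0; exists s.
  pose B x := [set sval q x | q in A].
  have B0 x : B x !=set0 by exists (sval q1 x), q1.
  have Blb x : E x -> has_lbound (B x).
    by move=> Ex; exists (- p (- x)) => _ [q Aq <-]; exact: T_lb.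
  pose m x := inf (B x).
  have mle (q : T p) x : E x -> A q -> m x <= sval q x.
    by move=> Ex Aq; apply: ge_inf; [exact: Blb|exists q].
  have sm : sublinear_on E m.
    split => [a x a0 Ex|x y Ex Ey].
      rewrite mulrC -ler_pdivrMr//; apply: lb_le_inf => // _ [q Aq <-].
      rewrite ler_pdivrMr// mulrC; apply: (le_trans (mle q _ _ Aq)).
        exact: vector_subspaceZ.
      exact: (svalP q).1.1.
    have key (qx qy : T p) : A qx -> A qy -> m (x + y) <= sval qx x + sval qy y.
      move=> Ax Ay; have Exy := vector_subspaceD sE Ex Ey.
      have [/asboolP H|/asboolP H] := totA _ _ Ax Ay.
        apply: (le_trans (mle _ _ Exy Ay)).
        apply: (le_trans ((svalP qy).1.2 _ _ Ex Ey)).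
        by rewrite lerD2r; exact: H.
      apply: (le_trans (mle _ _ Exy Ax)).
      apply: (le_trans ((svalP qx).1.2 _ _ Ex Ey)).
      by rewrite lerD2l; exact: H.
    rewrite -lerBlDl; apply: lb_le_inf => // _ [qy Ay <-].
    rewrite lerBlDl -lerBlDr; apply: lb_le_inf => // _ [qx Ax <-].
    by rewrite lerBlDr; exact: key.
  have mp x : E x -> m x <= p x.
    by move=> Ex; apply: (le_trans (mle _ _ Ex Aq1)); exact: (svalP q1).2.1.
  exists (mkT _ sm mp) => s As; apply/asboolP => x /=.
  have [Ex|nEx] := pselect (E x); first by rewrite restrE//; exact: mle.
  rewrite (svalP s).2.2// /restr; by case: pselect.
exists q; first by split.
move=> q' sq' q'q x Ex.
have q'p y : E y -> q' y <= p y.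
  by move=> Ey; exact: (le_trans (q'q _ Ey) (qp _ Ey)).
have /qmin/(congr1 sval)/= : below (exist _ q (conj sq (conj qp q0)))
    (mkT _ sq' q'p).
  apply/asboolP => y /=; have [Ey|nEy] := pselect (E y).
    by rewrite restrE// q'q.
  by rewrite q0// /restr; case: pselect.
by move=> <-; rewrite restrE.
Qed.

(** A minimal sublinear [q] is linear: for a fixed [y], the function
    [x |-> inf_(t >= 0) (q (x + t y) - t q y)] is sublinear and below [q],
    hence equal to [q], which says that [q x + q y <= q (x + y)]. *)
Lemma sublinear_dominates_linear p : sublinear_on E p ->
  exists2 phi, linear_on E phi & forall x, E x -> phi x <= p x.
Proof.
move=> /minimal_sublinear[q [sq qp] qmin]; exists q => //.
have superadd x y : E x -> E y -> q x + q y <= q (x + y).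
  move=> Ex Ey.
  pose B z := [set q (z + t *: y) - t * q y | t in [set t | 0 <= t]].
  have B0 z : B z !=set0 by exists (q (z + 0 *: y) - 0 * q y), 0 => /=.
  have Ez z t : E z -> E (z + t *: y).
    by move=> ?; apply: vector_subspaceD => //; exact: vector_subspaceZ.
  have qty t : 0 <= t -> q (t *: y) = t * q y.
    rewrite le_eqVlt => /predU1P[<-|t0]; last exact: sublinearZ.
    by rewrite scale0r mul0r sublinear0.
  have Blb z : E z -> has_lbound (B z).
    move=> Ez'; exists (- q (- z)) => _ [t /= t0 <-].
    have := sq.2 _ _ (Ez z t Ez') (vector_subspaceN sE Ez').
    by rewrite addrAC subrr add0r qty//; lra.
  pose m z := inf (B z).
  have mle z t : E z -> 0 <= t -> m z <= q (z + t *: y) - t * q y.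
    by move=> Ez' t0; apply: ge_inf; [exact: Blb|exists t].
  have sm : sublinear_on E m.
    split => [a z a0 Ez'|z z' Ez1 Ez2].
      rewrite mulrC -ler_pdivrMr//; apply: lb_le_inf => // _ [t/= t0 <-].
      rewrite ler_pdivrMr//.
      have at0 : 0 <= a * t by rewrite mulr_ge0// ltW.
      apply: (le_trans (mle _ _ (vector_subspaceZ a sE Ez') at0)).
      rewrite -scalerA -scalerDr sublinearZ//; last exact: Ez.
      by rewrite mulrBl mulrC; lra.
    rewrite -lerBlDl; apply: lb_le_inf => // _ [t /= t0 <-].
    rewrite lerBlDl -lerBlDr; apply: lb_le_inf => // _ [s /= s0 <-].
    rewrite lerBlDr.
    have ts0 : 0 <= s + t by rewrite addr_ge0.
    apply: (le_trans (mle _ _ (vector_subspaceD sE Ez1 Ez2) ts0)).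
    have := sq.2 _ _ (Ez _ s Ez1) (Ez _ t Ez2).
    rewrite addrACA -scalerDl; lra.
  have mq z : E z -> m z <= q z.
    by move=> Ez'; have := mle z 0 Ez' (lexx _); rewrite scale0r addr0 mul0r subr0.
  have := mle x 1 Ex ler01; rewrite (qmin _ sm mq)// scale1r mul1r; lra.
have qD x y : E x -> E y -> q (x + y) = q x + q y.
  by move=> Ex Ey; apply/eqP; rewrite eq_le superadd// sq.2.
have qN x : E x -> q (- x) = - q x.
  move=> Ex; have := qD _ _ Ex (vector_subspaceN sE Ex).
  by rewrite subrr sublinear0//; lra.
have qZ a x : E x -> q (a *: x) = a * q x.
  move=> Ex; have [a0|a0|<-] := ltgtP 0 a; last 1 first.
  - by rewrite scale0r mul0r sublinear0.
  - exact: sublinearZ.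
  - rewrite -[a]opprK scaleNr qN ?sublinearZ ?mulNr//.
      by rewrite oppr_gt0.
    exact: vector_subspaceZ.
move=> a b x y Ex Ey; rewrite qD ?qZ//; exact: vector_subspaceZ.
Qed.

(** The directional derivative [inf_(t > 0) (h (X + t x) - h X) / t] is finite
    and sublinear when [h] is finite and convex. *)
Lemma convex_subgradient h X : convex_on E h -> E X ->
  exists2 phi, linear_on E phi & forall x, E x -> phi x <= h (X + x) - h X.
Proof.
move=> ch EX.
pose B z := [set t^-1 * (h (X + t *: z) - h X) | t in [set t | 0 < t]].
have B0 z : B z !=set0.
  by exists (1^-1 * (h (X + 1 *: z) - h X)), 1 => //=.
have Ez z t : E z -> E (X + t *: z).
  by move=> ?; apply: vector_subspaceD => //; exact: vector_subspaceZ.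
have Blb z : E z -> has_lbound (B z).
  move=> Ez'; exists (h X - h (X - z)) => _ [t /= t0 <-].
  have t10 : 0 < 1 + t by lra.
  have s01 : 0 <= (1 + t)^-1 <= 1.
    by rewrite invr_ge0 ltW//= invf_le1//; lra.
  have := ch _ _ _ (Ez z t Ez') (Ez z (-1) Ez') s01.
  have -> : (1 + t)^-1 *: (X + t *: z) + (1 - (1 + t)^-1) *: (X + -1 *: z) = X.
    rewrite conv_translate !scalerA -scalerDl.
    have -> : (1 + t)^-1 * t + (1 - (1 + t)^-1) * -1 = 0 by field; lra.
    by rewrite scale0r addr0.
  rewrite scaleN1r => H.
  rewrite [leRHS]mulrC ler_pdivlMr//.
  have : (1 + t) * h X <= h (X + t *: z) + t * h (X - z).
    rewrite mulrC -ler_pdivlMr//; apply: (le_trans H).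
    rewrite le_eqVlt; apply/orP; left; apply/eqP; field; lra.
  lra.
pose p z := inf (B z).
have ple z t : E z -> 0 < t -> p z <= t^-1 * (h (X + t *: z) - h X).
  by move=> Ez' t0; apply: ge_inf; [exact: Blb|exists t].
have sp : sublinear_on E p.
  split => [a z a0 Ez'|z z' Ez1 Ez2].
    rewrite mulrC -ler_pdivrMr//; apply: lb_le_inf => // _ [t/= t0 <-].
    rewrite ler_pdivrMr//.
    have at0 : 0 < t / a by rewrite divr_gt0.
    apply: (le_trans (ple _ _ (vector_subspaceZ a sE Ez') at0)).
    rewrite scalerA divfK ?gt_eqF// invfM invrK.
    by rewrite mulrAC.
  rewrite -lerBlDl; apply: lb_le_inf => // _ [t /= t0 <-].
  rewrite lerBlDl -lerBlDr; apply: lb_le_inf => // _ [s /= s0 <-].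
  rewrite lerBlDr.
  have st0 : 0 < s + t by rewrite addr_gt0.
  pose r := s * t / (s + t).
  have r0 : 0 < r by rewrite divr_gt0// mulr_gt0.
  apply: (le_trans (ple _ _ (vector_subspaceD sE Ez1 Ez2) r0)).
  have u01 : 0 <= t / (s + t) <= 1.
    by rewrite divr_ge0 ?(ltW t0) ?(ltW st0)//= ler_pdivrMr//; lra.
  have := ch _ _ _ (Ez _ s Ez1) (Ez _ t Ez2) u01.
  have -> : (t / (s + t)) *: (X + s *: z) + (1 - t / (s + t)) *: (X + t *: z')
      = X + r *: (z + z').
    rewrite conv_translate scalerDr !scalerA.
    by congr (_ + (_ *: _ + _ *: _)); rewrite /r; field; lra.
  move=> H.
  have -> : s^-1 * (h (X + s *: z) - h X) + t^-1 * (h (X + t *: z') - h X) =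
    r^-1 * ((t / (s + t)) * h (X + s *: z) +
            (1 - t / (s + t)) * h (X + t *: z') - h X).
    by rewrite /r; field; rewrite ?gt_eqF.
  by rewrite ler_pM2l ?invr_gt0// lerD2r.
have [phi lphi phip] := sublinear_dominates_linear sp.
exists phi => // x Ex; apply: (le_trans (phip _ Ex)).
by have := ple x 1 Ex ltr01; rewrite invr1 mul1r scale1r.
Qed.

End fixed_subspace.
End subgradient.

(** * Expectations and almost sure limits *)

Section lower_limits.
Context {R : realType}.
Implicit Types (u : nat -> \bar R) (c : \bar R).
Local Open Scope ereal_scope.

Lemma limn_einf_le u c : (forall n, u n <= c) -> limn_einf u <= c.
Proof.
move=> uc; rewrite limn_einf_lim; apply: lime_le; first exact: is_cvg_einfs.
apply: nearW => n; apply: le_trans (uc n).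
by apply: ereal_inf_lbound; exists n => /=.
Qed.

Lemma lt_limn_einf u c : c < limn_einf u -> \forall n \near \oo, c < u n.
Proof.
rewrite limn_einf_lim (cvg_lim _ (@cvg_einfs_sup _ u))//.
move=> /ereal_sup_gt[_ [N _ <-] cN]; exists N => // n /= Nn.
by rewrite (lt_le_trans cN)//; apply: ereal_inf_lbound; exists n.
Qed.

Lemma half_series_lty : \sum_(n <oo) (2^-1 ^+ n : R)%:E < +oo.
Proof.
have -> : (fun n => \sum_(0 <= k < n) (2^-1 ^+ k : R)%:E) =
    eseries (fun k => (2 / (2 ^ (k + 1))%:R : R)%:E).
  apply/funext => n; apply: eq_bigr => k _.
  by rewrite addn1 expnS natrM natrX invfM mulrA divff// mul1r exprVn.
have /cvg_lim -> // := @cvg_geometric_eseries_half R 2 0.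
by rewrite ltry.
Qed.

End lower_limits.

Section expectations.
Context d {T : measurableType d} {R : realType} (P : probability T R).
Implicit Types f g : T -> R.
Local Notation intg f := (P.-integrable setT (EFin \o f)).
Local Notation Ex f := (Rintegral P setT f).

Lemma intg_measurable f : intg f -> measurable_fun setT f.
Proof. by move=> /measurable_int/measurable_EFinP. Qed.

Lemma ae_le_intg f g : measurable_fun setT f ->
  (\forall w \ae P, `|f w| <= g w) -> intg g -> intg f.
Proof.
move=> mf fg ig; apply/integrableP; split; first exact/measurable_EFinP.
have mg := intg_measurable ig.
case/integrableP : ig => _; apply: le_lt_trans.
apply: ae_ge0_le_integral => //.
- by do 2 apply: measurableT_comp => //.
- by do 2 apply: measurableT_comp => //.
- move: fg; apply: filterS => w fg _ /=.
  by rewrite lee_fin (le_trans fg)// ler_norm.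
Qed.

Lemma ae_eq_intg f g : measurable_fun setT f ->
  (\forall w \ae P, f w = g w) -> intg g -> intg f.
Proof.
move=> mf fg ig; apply: (ae_le_intg (g := fun w => `|g w|)) => //.
  by move: fg; apply: filterS => w ->.
exact: integrable_norm.
Qed.

Lemma intg_cst (c : R) : intg (fun=> c).
Proof. exact: finite_measure_integrable_cst. Qed.

Lemma bounded_intg f (c : R) : measurable_fun setT f ->
  (\forall w \ae P, `|f w| <= c) -> intg f.
Proof. by move=> mf fc; apply: (ae_le_intg mf fc); exact: intg_cst. Qed.

Lemma intgD f g : intg f -> intg g -> intg (fun w => f w + g w).
Proof. by move=> if1 ig; exact: (integrableD measurableT if1 ig). Qed.

Lemma intgB f g : intg f -> intg g -> intg (fun w => f w - g w).
Proof. by move=> if1 ig; exact: (integrableB measurableT if1 ig). Qed.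

Lemma intgZ (a : R) f : intg f -> intg (fun w => a * f w).
Proof. by move=> if1; exact: (integrableZl measurableT a if1). Qed.

Lemma intgN f : intg f -> intg (fun w => - f w).
Proof. by move=> if1; exact: (integrableN if1). Qed.

Lemma intg_norm f : intg f -> intg (fun w => `|f w|).
Proof. by move=> if1; exact: (integrable_norm if1). Qed.

Lemma ExD f g : intg f -> intg g ->
  Ex (fun w => f w + g w) = Ex f + Ex g.
Proof. exact: RintegralD. Qed.

Lemma ExB f g : intg f -> intg g ->
  Ex (fun w => f w - g w) = Ex f - Ex g.
Proof. exact: RintegralB. Qed.

Lemma ExZ (a : R) f : intg f -> Ex (fun w => a * f w) = a * Ex f.
Proof. by move=> if1; exact: RintegralZl. Qed.

Lemma Ex_cst (c : R) : Ex (fun=> c) = c.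
Proof. by rewrite Rintegral_cst//= probability_setT mulr1. Qed.

Lemma ae_eq_Ex f g : measurable_fun setT f -> measurable_fun setT g ->
  (\forall w \ae P, f w = g w) -> Ex f = Ex g.
Proof.
move=> mf mg fg; congr fine; apply: ae_eq_integral => //.
- exact/measurable_EFinP.
- exact/measurable_EFinP.
- by move: fg; apply: filterS => w ->.
Qed.

Lemma ae_Ex_ge0 f : measurable_fun setT f ->
  (\forall w \ae P, 0 <= f w) -> 0 <= Ex f.
Proof.
move=> mf f0; have -> : Ex f = Ex (fun w => Num.max (f w) 0).
  apply: ae_eq_Ex => //; first exact: measurable_maxr.
  by move: f0; apply: filterS => w ?; rewrite max_l.
by apply: Rintegral_ge0 => w _; rewrite le_max lexx orbT.
Qed.

Lemma ae_le_Ex f g : intg f -> intg g ->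
  (\forall w \ae P, f w <= g w) -> Ex f <= Ex g.
Proof.
move=> if1 ig fg; rewrite -subr_ge0 -ExB//; apply: ae_Ex_ge0.
  by apply: measurable_funB; exact: intg_measurable.
by move: fg; apply: filterS => w; rewrite subr_ge0.
Qed.

Lemma EFin_Ex f : intg f -> (\int[P]_w (f w)%:E)%E = (Ex f)%:E.
Proof. by move=> if1; rewrite fineK//; exact: integrable_fin_num. Qed.

Lemma ge0_intg f (c : R) : measurable_fun setT f ->
  (\forall w \ae P, 0 <= f w) -> (\int[P]_w (f w)%:E <= c%:E)%E -> intg f.
Proof.
move=> mf f0 fc; apply/integrableP; split; first exact/measurable_EFinP.
apply: le_lt_trans (ltry c); rewrite (le_trans _ fc)//.
rewrite le_eqVlt; apply/orP; left; apply/eqP; apply: ae_eq_integral => //.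
- by do 2 apply: measurableT_comp => //.
- exact/measurable_EFinP.
- by move: f0; apply: filterS => w ? _ /=; rewrite ger0_norm.
Qed.

Lemma ae_dominated_Ex_cvg (f_ : nat -> T -> R) f g :
  (forall n, measurable_fun setT (f_ n)) -> measurable_fun setT f ->
  (\forall w \ae P, f_ n w @[n --> \oo] --> f w) ->
  (forall n, \forall w \ae P, `|f_ n w| <= g w) -> intg g ->
  Ex (f_ n) @[n --> \oo] --> Ex f.
Proof.
move=> mf_ mf ff fg ig.
have [|||||if1 _ cv] := @dominated_convergence _ T R P setT measurableT
    (fun n => EFin \o f_ n) (EFin \o f) (EFin \o g).
- by move=> n; exact/measurable_EFinP.
- exact/measurable_EFinP.
- by move: ff; apply: filterS => w ff _; exact/cvg_EFin/ff/nearW.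
- exact: ig.
- by move: (ae_foralln fg); apply: filterS => w fg' n _ /=; rewrite lee_fin.
move: cv; rewrite EFin_Ex// => /fine_cvg.
by apply: cvg_trans.
Qed.

Lemma ae_fatou_integral (f_ : nat -> T -> R) f (c : R) :
  (forall n, measurable_fun setT (f_ n)) -> measurable_fun setT f ->
  (\forall w \ae P, f_ n w @[n --> \oo] --> f w) ->
  (forall n, \forall w \ae P, 0 <= f_ n w) ->
  (forall n, \int[P]_w (f_ n w)%:E <= c%:E)%E ->
  (\forall w \ae P, 0 <= f w) /\ (\int[P]_w (f w)%:E <= c%:E)%E.
Proof.
move=> mf_ mf ff f0 fc.
have ff0 : \forall w \ae P, 0 <= f w.
  move: (ae_foralln f0) ff; apply: filterS2 => w f0w ffw.
  rewrite -(cvg_lim _ ffw)//; apply: limr_ge; first by apply/cvg_ex; exists (f w).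
  exact: nearW.
split=> //.
have -> : (\int[P]_w (f w)%:E = \int[P]_w limn_einf (fun n => `|(f_ n w)%:E|))%E.
  apply: ae_eq_integral => //.
  - exact/measurable_EFinP.
  - apply: measurableT_comp => //; apply: measurable_fun_limn_esup => n.
    by apply: measurableT_comp => //; do 2 apply: measurableT_comp => //.
  - move: ff0 ff; apply: filterS2 => w f0w ffw _.
    rewrite is_cvg_limn_einfE; last first.
      apply/cvg_ex; exists `|(f w)%:E|%E; apply: cvg_abse.
      exact/cvg_EFin/ffw/nearW.
    apply/esym/cvg_lim => //; rewrite -[(f w)%:E]gee0_abs ?lee_fin//.
    by apply: cvg_abse; exact/cvg_EFin/ffw/nearW.
apply: le_trans (fatou _ _ _ _) _ => //.
  by move=> n; do 2 apply: measurableT_comp => //.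
apply: limn_einf_le => n.
rewrite (le_trans _ (fc n))// le_eqVlt; apply/orP; left; apply/eqP.
apply: ae_eq_integral => //.
- by do 2 apply: measurableT_comp => //.
- exact/measurable_EFinP.
- by move: (f0 n); apply: filterS => w ? _ /=; rewrite ger0_norm.
Qed.

Lemma ae_Ex0 f : intg f -> (\forall w \ae P, 0 <= f w) -> Ex f = 0 ->
  \forall w \ae P, f w = 0.
Proof.
move=> if1 f0 Ef.
have mf := intg_measurable if1.
have : (\int[P]_w `|(f w)%:E| = 0)%E.
  rewrite -[RHS](congr1 EFin Ef) -EFin_Ex//; apply: ae_eq_integral => //.
  - by do 2 apply: measurableT_comp => //.
  - exact/measurable_EFinP.
  - by move: f0; apply: filterS => w ? _ /=; rewrite ger0_norm.
move/(ae_eq_integral_abs _ measurableT); rewrite measurable_EFinP => /(_ mf).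
by apply: filterS => w /(_ I)[].
Qed.

(** The series of the increments has a finite integral, so that it is finite
    almost surely and the telescoping series converges absolutely. *)
Lemma summable_Ex_ae_cvg (y_ : nat -> T -> R) :
  (forall n, intg (y_ n)) ->
  (forall n, Ex (fun w => `|y_ n.+1 w - y_ n w|) <= 2^-1 ^+ n) ->
  \forall w \ae P, cvgn (fun n => y_ n w).
Proof.
move=> iy dy.
have iD n : intg (fun w => `|y_ n.+1 w - y_ n w|) by apply/intg_norm/intgB.
pose S w := (\sum_(n <oo) `|y_ n.+1 w - y_ n w|%:E)%E.
have mS : measurable_fun setT S.
  apply: ge0_emeasurable_sum => // n _.
  by apply/measurable_EFinP/intg_measurable; exact: iD.
have S0 w : (0 <= S w)%E by apply: nneseries_ge0.
have iS : P.-integrable setT S.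
  apply/integrableP; split => //.
  under eq_integral do rewrite gee0_abs//.
  rewrite integral_nneseries//; last first.
    by move=> n; apply/measurable_EFinP/intg_measurable; exact: iD.
  apply: le_lt_trans half_series_lty.
  apply: lee_nneseries => [n _ _|n _].
    by apply: integral_ge0 => w _; rewrite lee_fin.
  by rewrite EFin_Ex// lee_fin (le_trans (dy n)).
have := integrable_ae measurableT iS; apply: filterS => w /(_ I) fS.
have : cvgn (series (fun n => y_ n.+1 w - y_ n w)).
  apply/normed_cvg/nnseries_is_cvg => [n /=|]; first exact: normr_ge0.
  by move: fS; rewrite ge0_fin_numE.
have -> : series (fun n => y_ n.+1 w - y_ n w) = (fun n => y_ n w - y_ 0 w).
  by apply/funext => n; rewrite seriesEnat /= telescope_sumr.
move=> /cvg_ex[/= l yl]; apply/cvg_ex; exists (l + y_ 0 w).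
rewrite (_ : (fun n => y_ n w) = (fun n => y_ n w - y_ 0 w + y_ 0 w)).
  by apply: cvgD => //; exact: cvg_cst.
by apply/funext => n; rewrite subrK.
Qed.

Lemma small_sets_ae_eventually (A : nat -> set T) :
  (forall n, measurable (A n)) ->
  (forall n, P (A n) <= (2^-1 ^+ n)%:E)%E ->
  \forall w \ae P, exists N, forall n, (N <= n)%N -> ~ A n w.
Proof.
move=> mA PA; exists (lim_sup_set A); split.
- by apply: bigcapT_measurable => n; apply: bigcup_measurable.
- apply: lim_sup_set_cvg0 => //.
  apply: le_lt_trans half_series_lty.
  by apply: lee_nneseries => [n _ _|n _]; [exact: measure_ge0|exact: PA].
- move=> w /= /forallNP nw n _; apply: contrapT => An; apply: (nw n) => k nk Ak.
  by apply: An; exists k.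
Qed.

End expectations.

(** * Order continuous functionals are expectations *)

Section real_sequences.
Context {R : realType}.
Implicit Types (u v : nat -> R) (a b : R).

Lemma cvg_cst_seq a : (fun=> a) @ \oo --> a. Proof. exact: cvg_cst. Qed.

Lemma cvgD_seq u v a b : u @ \oo --> a -> v @ \oo --> b ->
  (fun n => u n + v n) @ \oo --> a + b.
Proof. exact: cvgD. Qed.

Lemma cvgB_seq u v a b : u @ \oo --> a -> v @ \oo --> b ->
  (fun n => u n - v n) @ \oo --> a - b.
Proof. exact: cvgB. Qed.

Lemma cvgZ_seq c u a : u @ \oo --> a -> (fun n => c * u n) @ \oo --> c * a.
Proof. exact: cvgMl_tmp. Qed.

Lemma cvg_norm_seq u a : u @ \oo --> a -> (fun n => `|u n|) @ \oo --> `|a|.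
Proof. exact: cvg_norm. Qed.

Lemma cvg_seqP u a : u @ \oo --> a <->
  forall e, 0 < e -> exists N, forall n, (N <= n)%N -> `|u n - a| <= e.
Proof.
split=> [/cvgrPdist_le ua e e0|ua].
  by have [N _ HN] := ua _ e0; exists N => n Nn; rewrite distrC; exact: HN.
apply/cvgrPdist_le => e e0; have [N HN] := ua _ e0.
by exists N => // n /= Nn; rewrite distrC; exact: HN.
Qed.

End real_sequences.
Arguments cvg_cst_seq {R} a.

Section pointwise.
Context d {T : measurableType d} {R : realType}.
Local Notation M := {mfun T >-> R}.
Implicit Types X Y : M.

Let addE X Y w : (X + Y) w = X w + Y w. Proof. by []. Qed.
Let oppE X w : (- X) w = - X w. Proof. by []. Qed.
Let mulE X Y w : (X * Y) w = X w * Y w. Proof. by []. Qed.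
Let scaleE (a : R) X w : (a *: X) w = a * X w. Proof. by []. Qed.
Let zeroE w : (0 : M) w = 0. Proof. by []. Qed.
Let cstE (a : R) w : (cst a : M) w = a. Proof. by []. Qed.
Let maxE X Y w : max_mfun X Y w = Num.max (X w) (Y w). Proof. by []. Qed.
Let minE X Y w : min_mfun X Y w = Num.min (X w) (Y w). Proof. by []. Qed.

Definition mfE := (addE, oppE, mulE, scaleE, zeroE, cstE, maxE, minE).

Lemma sum_mfunE n (X_ : nat -> M) w :
  (\sum_(i < n) X_ i) w = \sum_(i < n) X_ i w.
Proof.
elim: n => [|n IH]; first by rewrite !big_ord0.
by rewrite !big_ord_recr mfE IH.
Qed.

End pointwise.

Section solid_space_closure.
Context d {T : measurableType d} {R : realType} (P : probability T R).
Local Notation M := {mfun T >-> R}.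
Implicit Types (E : set M) (X Y Z : M).
Variable E : set M.
Hypothesis E_solid : solid_space P E.

Lemma solid_subspace : vector_subspace E.
Proof.
have [[E0 sE] dE] := E_solid; split => //.
by rewrite (_ : 0 = cst 0 :> M)//; exact/mfuneqP.
Qed.

Lemma solid_le X Y : E Y -> (forall w, `|X w| <= `|Y w|) -> E X.
Proof. by move=> EY XY; apply: E_solid.2 EY; exact: aeW. Qed.

Lemma solid_ae X Y : E Y -> (\forall w \ae P, `|X w| <= Y w) -> E X.
Proof.
move=> EY XY; apply: E_solid.2 EY; move: XY; apply: filterS => w XY.
by rewrite (le_trans XY)// ler_norm.
Qed.

End solid_space_closure.

Section representation.
Context d {T : measurableType d} {R : realType} (P : probability T R).
Local Notation M := {mfun T >-> R}.
Local Notation intg f := (P.-integrable setT (EFin \o f)).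
Local Notation Ex f := (Rintegral P setT f).
Variables (E : set M) (phi : M -> R).
Hypothesis E_solid : solid_space P E.
Hypothesis E_cst : contains_constants P E.
Hypothesis phi_lin : linear_on E phi.
Hypothesis phi_ge0 : forall X, E X -> (\forall w \ae P, 0 <= X w) -> 0 <= phi X.
Hypothesis phi_cont : forall (U_ : nat -> M) Y, E Y ->
  (forall n w, 0 <= U_ n w <= Y w) -> (forall w, U_ n w @[n --> \oo] --> 0) ->
  phi (U_ n) @[n --> \oo] --> 0.

Let sE := solid_subspace E_solid.

Let phiD X Y : E X -> E Y -> phi (X + Y) = phi X + phi Y.
Proof.
by move=> EX EY; have := phi_lin 1 1 EX EY; rewrite !scale1r !mul1r.
Qed.

Let phi0 : phi 0 = 0.
Proof. by have := phi_lin 0 0 sE.1 sE.1; rewrite scaler0 addr0 !mul0r addr0. Qed.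

Let phiZ (a : R) X : E X -> phi (a *: X) = a * phi X.
Proof.
by move=> EX; have := phi_lin a 0 EX sE.1; rewrite scaler0 mul0r !addr0.
Qed.

Let phiB X Y : E X -> E Y -> phi (X - Y) = phi X - phi Y.
Proof.
move=> EX EY; have := phi_lin 1 (-1) EX EY.
by rewrite scale1r scaleN1r mul1r mulN1r.
Qed.

Let phi_sum n (X_ : nat -> M) : (forall i, E (X_ i)) ->
  E (\sum_(i < n) X_ i) /\ phi (\sum_(i < n) X_ i) = \sum_(i < n) phi (X_ i).
Proof.
move=> EX; elim: n => [|n [En IH]]; first by rewrite !big_ord0; split=> //; exact: sE.1.
rewrite !big_ord_recr/= phiD// IH; split => //; exact: vector_subspaceD.
Qed.

Let phi_le X Y : E X -> E Y -> (\forall w \ae P, X w <= Y w) -> phi X <= phi Y.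
Proof.
move=> EX EY XY; rewrite -subr_ge0 -phiB//; apply: phi_ge0.
  exact: vector_subspaceB.
by move: XY; apply: filterS => w XY; rewrite /= subr_ge0.
Qed.

Let ind (A : set T) : M := if pselect (measurable A) is left mA
  then indic_mfun A mA else 0.

Let indE A w : measurable A -> ind A w = \1_A w.
Proof. by rewrite /ind; case: pselect. Qed.

Let E_ind A : E (ind A).
Proof.
rewrite /ind; case: pselect => [mA|_]; last exact: sE.1.
apply: (solid_le E_solid (E_cst 1)) => w /=.
by rewrite /mindic indicE normr1; case: (_ \in _); rewrite ?normr0 ?normr1.
Qed.

Let nu (A : set T) : \bar R := (phi (ind A))%:E.

Let nu0 : nu set0 = 0%E.
Proof.
rewrite /nu (_ : ind set0 = 0) ?phi0//; apply/mfuneqP => w.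
by rewrite indE// indic0.
Qed.

Let nu_fin A : measurable A -> nu A \is a fin_num. Proof. by []. Qed.

Let nu_sigma_additive : semi_sigma_additive nu.
Proof.
move=> F mF tF mUF.
pose U n := ind (\bigcup_n F n) - \sum_(i < n) ind (F i).
have EU n : E (\sum_(i < n) ind (F i)) by have [] := phi_sum n (fun i => E_ind (F i)).
have phiU n : phi (U n) = phi (ind (\bigcup_n F n)) - \sum_(i < n) phi (ind (F i)).
  by rewrite /U phiB//; congr (_ - _); have [] := phi_sum n (fun i => E_ind (F i)).
have Uw n w : U n w = \1_(\bigcup_n F n) w - \sum_(i < n) \1_(F i) w.
  rewrite /U !mfE (sum_mfunE n (fun i => ind (F i))) indE//; congr (_ - _).
  by apply: eq_bigr => i _; rewrite indE.
have sum0 n w : (forall i, (i < n)%N -> ~ F i w) -> \sum_(i < n) \1_(F i) w = 0 :> R.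
  by move=> nF; rewrite big1// => i _; rewrite indicE memNset//; exact: nF.
have sum1 n i w : (i < n)%N -> F i w -> \sum_(i < n) \1_(F i) w = 1 :> R.
  move=> iltn Fiw; rewrite (bigD1 (Ordinal iltn))//= indicE mem_set// big1 ?addr0//.
  move=> j ji; rewrite indicE memNset// => Fjw; move/eqP: ji; apply.
  by apply/val_inj => /=; apply: (tF _ _ I I); exists w.
have U01 n w : 0 <= U n w <= cst 1 w.
  rewrite Uw /=.
  have [[i iltn Fiw]|nF] := pselect (exists2 i, (i < n)%N & F i w).
    rewrite (sum1 _ _ _ iltn Fiw) indicE mem_set ?subrr ?lexx ?ler01//.
    by exists i.
  rewrite sum0 ?subr0; last by move=> i iltn Fiw; apply: nF; exists i.
  by rewrite indicE; case: (_ \in _); rewrite ?lexx ?ler01.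
have U0 w : U n w @[n --> \oo] --> 0.
  have [[i _ Fiw]|nF] := pselect ((\bigcup_n F n) w).
    apply: cvg_near_cst; near=> n; rewrite Uw (sum1 _ i)//.
      by rewrite indicE mem_set ?subrr//; exists i.
    by near: n; exists i.+1.
  apply: cvg_near_cst; apply: nearW => n.
  rewrite Uw sum0 ?subr0 ?indicE ?memNset// => i _ Fiw.
  by apply: nF; exists i.
have := phi_cont (E_cst 1) U01 U0.
have -> : (fun n => \sum_(0 <= i < n) nu (F i))%E =
    (fun n => (\sum_(i < n) phi (ind (F i)))%:E).
  by apply/funext => n; rewrite big_mkord sumEFin.
move=> phiU0; apply/cvg_EFin; first exact: nearW.
rewrite (_ : _ \o _ = fun n => phi (ind (\bigcup_n F n)) - phi (U n)).
  by rewrite -[X in _ --> X]subr0; apply: cvgB => //; exact: cvg_cst.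
by apply/funext => n /=; rewrite phiU; lra.
Unshelve. all: by end_near. Qed.

Let nu_charge : {charge set T -> \bar R} := HB.pack nu
  (isCharge.Build _ T R nu nu0 nu_fin nu_sigma_additive).

Let nu_dominated : nu_charge `<< P.
Proof.
apply/null_content_dominatesP => A mA PA0.
have ind0 : \forall w \ae P, ind A w = 0.
  exists A; split => // w /= nw; apply: contrapT => nAw; apply: nw.
  by rewrite indE// indicE memNset.
congr EFin; apply/eqP; rewrite eq_le; apply/andP; split.
  rewrite -phi0; apply: phi_le => //; first exact: sE.1.
  by move: ind0; apply: filterS => w ->.
by apply: phi_ge0 => //; move: ind0; apply: filterS => w ->.
Qed.

(* Nonnegativity is obtained by testing [phi] on the indicator of [Z < 0]. *)
Let density : exists Z : M, [/\ intg Z, (\forall w \ae P, 0 <= Z w) &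
  forall A, measurable A -> intg (ind A \* Z) /\ phi (ind A) = Ex (ind A \* Z)].
Proof.
have iRN := Radon_Nikodym_integrable nu_dominated.
pose z := fun w => fine (Radon_Nikodym nu_charge P w).
have zRN w : (z w)%:E = Radon_Nikodym nu_charge P w.
  by rewrite fineK//; exact: Radon_Nikodym_fin_num.
have mz : measurable_fun setT z.
  by apply: measurableT_comp => //; exact: measurable_int iRN.
pose Z : M := HB.pack z (isMeasurableFun.Build _ _ _ _ z mz).
have iZ : intg Z by rewrite (_ : _ \o _ = Radon_Nikodym nu_charge P)//; apply/funext.
have indZ A : measurable A -> intg (ind A \* Z) /\ phi (ind A) = Ex (ind A \* Z).
  move=> mA; have iAZ : intg (ind A \* Z).
    apply: (ae_le_intg (g := fun w => `|Z w|)) => //; last exact: intg_norm.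
    apply: aeW => w /=; rewrite indE// indicE normrM.
    by case: (_ \in _); rewrite ?normr0 ?normr1 ?mul1r// mul0r.
  split => //; apply: EFin_inj; rewrite -EFin_Ex//.
  have -> : (phi (ind A))%:E = nu_charge A by [].
  rewrite (Radon_Nikodym_integral nu_dominated mA).
  rewrite integral_mkcond; apply: eq_integral => w _.
  rewrite patchE /= indE// indicE; case: ifPn => _; first by rewrite mul1r zRN.
  by rewrite mul0r.
exists Z; split => //.
pose A := [set w | Z w < 0].
have mA : measurable A.
  by rewrite -[A]setTI; exact: measurable_fun_ltr.
have [iAZ EAZ] := indZ _ mA.
have AZle w : (ind A \* Z) w <= 0.
  rewrite /= indE// indicE; case: (boolP (w \in A)) => wA.
    by rewrite mul1r ltW//; rewrite inE in wA.
  by rewrite mul0r.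
have : \forall w \ae P, - (ind A \* Z) w = 0.
  apply: (ae_Ex0 (f := fun w => - (ind A \* Z) w)); first exact: intgN.
    by apply: aeW => w; rewrite oppr_ge0.
  apply/eqP; rewrite eq_le; apply/andP; split; last first.
    apply: Rintegral_ge0 => w _; by rewrite oppr_ge0.
  under eq_Rintegral do rewrite -mulN1r.
  rewrite ExZ// -EAZ mulN1r oppr_le0; apply: phi_ge0 => //.
  by apply: aeW => w; rewrite indE.
apply: filterS => w; rewrite /= indE// indicE; case: (boolP (w \in A)) => wA.
  by rewrite mul1r => /eqP; rewrite oppr_eq0 => /eqP ->.
by rewrite notin_setE in wA; move: wA => /negP; rewrite -leNgt.
Qed.

Import HBSimple HBNNSimple.

(** An order continuous positive functional is integration against its
    Radon-Nikodym density: this holds on indicators, hence on simple functions,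
    and a nonnegative [X] is a limit of simple functions below [X]. *)
Lemma order_continuous_representation : exists Z : M,
  [/\ intg Z, (\forall w \ae P, 0 <= Z w) &
   forall X, E X -> intg (X \* Z) /\ phi X = Ex (X \* Z)].
Proof.
have [Z [iZ Z0 indZ]] := density; exists Z; split => //.
have pos (X : M) : E X -> (forall w, 0 <= X w) -> intg (X \* Z) /\ phi X = Ex (X \* Z).
  move=> EX X0.
  have mX : measurable_fun setT (EFin \o X) by exact/measurable_EFinP.
  have X0' (w : T) : setT w -> (0 <= (EFin \o X) w)%E by rewrite lee_fin.
  pose s n : M := nnsfun_approx measurableT mX n.
  have sX n w : s n w <= X w.
    rewrite -lee_fin -[s n w]/(nnsfun_approx measurableT mX n w) nnsfun_approxE.
    exact: le_approx.
  have s0 n w : 0 <= s n w by exact: fun_ge0.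
  have sc w : s n w @[n --> \oo] --> X w.
    have := @cvg_nnsfun_approx _ _ _ _ measurableT _ mX X0' w I.
    by move=> /fine_cvg.
  have Es n : E (s n).
    by apply: (solid_le E_solid EX) => w; rewrite !ger0_norm.
  have sZ n : intg (s n \* Z) /\ phi (s n) = Ex (s n \* Z).
    pose r := finmap.enum_fset (fset_set (range (s n))).
    pose G i : M := r`_i *: ind (s n @^-1` [set r`_i]).
    have mG i : measurable (s n @^-1` [set r`_i]).
      by rewrite -[X in measurable X]setTI; exact: measurable_funP.
    have -> : s n = \sum_(i < size r) G i.
      apply/mfuneqP => w; rewrite (sum_mfunE _ G) /r [LHS]fimfunEord.
      by apply: eq_bigr => i _; rewrite /G mfE indE.
    have EG i : E (G i) by exact: vector_subspaceZ.
    have GZ i : intg (G i \* Z) /\ phi (G i) = Ex (G i \* Z).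
      have [iA EA] := indZ _ (mG i).
      rewrite /G phiZ// EA (_ : (_ \* Z) =
          (fun w => r`_i * (ind (s n @^-1` [set r`_i]) \* Z) w)).
        by split; [exact: intgZ|rewrite ExZ].
      by apply/funext => w; rewrite /= mulrA.
    have [_ ->] := phi_sum (size r) EG.
    elim: (size r) => [|n' [IHi IHe]].
      rewrite !big_ord0 (_ : (_ \* Z) = fun=> 0).
        by split; [exact: intg_cst|rewrite Ex_cst].
      by apply/funext => w; exact: mul0r.
    rewrite !big_ord_recr (_ : (_ \* Z) = (fun w =>
        ((\sum_(i < n') G i : M) \* Z) w + (G n' \* Z) w)); last first.
      by apply/funext => w; exact: mulrDl.
    split.
      by apply: intgD => //; case: (GZ n').
    rewrite IHe (GZ n').2; apply/esym/ExD => //; by case: (GZ n').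
  have ffE n : phi (s n) <= phi X.
    by apply: phi_le => //; exact: aeW.
  have iXZ : intg (X \* Z).
    have sZX : \forall w \ae P, (s n \* Z) w @[n --> \oo] --> (X \* Z) w.
      by apply: aeW => w; exact: (cvgMr_tmp (b := Z w) (sc w)).
    have sZ0 n : \forall w \ae P, 0 <= (s n \* Z) w.
      by move: Z0; apply: filterS => w Zw; exact: mulr_ge0.
    have sZle n : (\int[P]_w ((s n \* Z) w)%:E <= (phi X)%:E)%E.
      by rewrite EFin_Ex -?(sZ n).2 ?lee_fin//; case: (sZ n).
    have [XZ0 XZle] := ae_fatou_integral (fun n => measurable_funPT (s n \* Z))
      (measurable_funPT (X \* Z)) sZX sZ0 sZle.
    exact: ge0_intg XZle.
  split => //.
  have c1 : phi (s n) @[n --> \oo] --> phi X.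
    have U0 w : (X - s n) w @[n --> \oo] --> 0.
      by rewrite -(subrr (X w)); exact: (cvgB_seq (cvg_cst_seq (X w)) (sc w)).
    have Ub n w : 0 <= (X - s n) w <= X w.
      by rewrite subr_ge0 sX/= lerBlDr lerDl s0.
    have := phi_cont EX Ub U0.
    move=> /(cvgB_seq (cvg_cst_seq (phi X))); rewrite subr0.
    apply: cvg_trans; apply: near_eq_cvg; apply: nearW => n /=.
    by rewrite phiB// opprB addrC subrK.
  have c2 : phi (s n) @[n --> \oo] --> Ex (X \* Z).
    under eq_fun do rewrite (sZ _).2.
    apply: (ae_dominated_Ex_cvg (g := fun w => `|(X \* Z) w|)) => //.
    - by apply: aeW => w; exact: (cvgMr_tmp (b := Z w) (sc w)).
    - by move=> n; apply: aeW => w; rewrite !normrM ler_wpM2r// !ger0_norm.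
    - exact: intg_norm.
  by rewrite -(cvg_lim _ c1)// -(cvg_lim _ c2).
move=> X EX.
pose Xp : M := max_mfun X (cst 0).
pose Xn : M := max_mfun (- X) (cst 0).
have EXp : E Xp.
  by apply: (solid_le E_solid EX) => w /=; case: (ltP (X w) 0) => //; rewrite normr0.
have EXn : E Xn.
  apply: (solid_le E_solid EX) => w /=.
  by case: (ltP (- X w) 0) => //; rewrite ?normr0// normrN.
have XE : X = Xp - Xn.
  apply/mfuneqP => w; rewrite /Xp /Xn !mfE.
  by case: (ltP (X w) 0) => X0; case: (ltP (- X w) 0) => X1; lra.
have [ip Ep] := pos _ EXp ltac:(by move=> w /=; rewrite le_max lexx orbT).
have [im En] := pos _ EXn ltac:(by move=> w /=; rewrite le_max lexx orbT).
rewrite XE phiB// Ep En (_ : (_ \* Z) = fun w => (Xp \* Z) w - (Xn \* Z) w).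
  by split; [exact: intgB|rewrite ExB].
by apply/funext => w; exact: mulrBl.
Qed.

End representation.

(** * The conjugate on bounded random variables *)

Section conjugate.
Context d {T : measurableType d} {R : realType} (P : probability T R).
Local Notation M := {mfun T >-> R}.
Local Notation intg f := (P.-integrable setT (EFin \o f)).
Local Notation Ex f := (Rintegral P setT f).
Local Notation dom := (@dom_conj_Loo d T R P).
Implicit Types (X Y Z V : M).

Definition ae_bounded X := exists c : R, \forall w \ae P, `|X w| <= c.

Lemma LooP X : @Loo d T R P X <-> ae_bounded X.
Proof.
have P0 : (0 < P setT)%E by rewrite probability_setT lte01.
rewrite /Loo /= inE; split=> [/andP[_]|[c Xc]].
  rewrite inE /= /finite_norm unlock /Lnorm P0 => Xfin.
  exists (fine (Order.max (ess_sup P (abse \o (EFin \o X))) 0%E)).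
  have /ess_supP : (ess_sup P (abse \o (EFin \o X)) <=
      Order.max (ess_sup P (abse \o (EFin \o X))) 0)%E by rewrite le_max lexx.
  apply: filterS => w /=; rewrite -lee_fin fineK// fin_numElt gt_max Xfin ltry.
  by rewrite lt_max ltNyr orbT.
apply/andP; split; first exact: mfunP.
rewrite inE /= /finite_norm unlock /Lnorm P0.
apply: (@le_lt_trans _ _ c%:E); last exact: ltry.
by apply/ess_supP; move: Xc; apply: filterS => w; rewrite lee_fin.
Qed.

Lemma L1P Z : L1 P Z <-> intg Z.
Proof. exact: Lfun1_integrable. Qed.

Lemma ae_bounded_cst (c : R) : ae_bounded (cst c).
Proof. by exists `|c|; exact: aeW. Qed.

Lemma ae_bounded_comb (a b : R) X Y : ae_bounded X -> ae_bounded Y ->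
  ae_bounded (a *: X + b *: Y).
Proof.
move=> [c Xc] [c' Yc]; exists (`|a| * c + `|b| * c').
move: Xc Yc; apply: filterS2 => w Xc Yc; rewrite !mfE.
by rewrite (le_trans (ler_normD _ _))// !normrM lerD// ler_wpM2l.
Qed.

Lemma ae_bounded_le X Y : (\forall w \ae P, `|X w| <= `|Y w|) ->
  ae_bounded Y -> ae_bounded X.
Proof.
move=> XY [c Yc]; exists c; move: XY Yc; apply: filterS2 => w.
exact: le_trans.
Qed.

Lemma bounded_solid : solid_space P (ae_bounded : set M).
Proof.
split; last by move=> X Y XY; exact: ae_bounded_le.
by split; [exact: ae_bounded_cst|move=> a b X Y; exact: ae_bounded_comb].
Qed.

Lemma bounded_intgM X Z : ae_bounded X -> intg Z -> intg (X \* Z).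
Proof.
move=> [c Xc] iZ.
apply: (ae_le_intg (g := fun w => c * `|Z w|)) => //.
  by move: Xc; apply: filterS => w Xc; rewrite normrM ler_wpM2r.
exact/intgZ/intg_norm.
Qed.

Lemma intgM_comb (a b : R) X Y Z : intg (X \* Z) -> intg (Y \* Z) ->
  intg ((a *: X + b *: Y : M) \* Z) /\
  Ex ((a *: X + b *: Y : M) \* Z) = a * Ex (X \* Z) + b * Ex (Y \* Z).
Proof.
move=> iX iY.
rewrite (_ : (_ \* Z) = fun w => a * (X \* Z) w + b * (Y \* Z) w).
  by split; [apply: intgD; exact: intgZ|rewrite ExD ?ExZ//; exact: intgZ].
apply/funext => w; rewrite -[LHS]/((a *: X + b *: Y : M) w * Z w) !mfE.
by rewrite mulrDl -!mulrA.
Qed.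

Variables (E : set M) (psi : M -> R).
Hypothesis E_solid : solid_space P E.
Hypothesis E_cst : contains_constants P E.
Hypothesis psi_mc : monotone_convex P E psi.
Let sE := solid_subspace E_solid.

Lemma psi_convex : convex_on E psi.
Proof.
move=> x y t Ex' Ey /andP[t0 t1].
have xE : (x : M) \in (E : set M) by rewrite inE.
have yE : (y : M) \in (E : set M) by rewrite inE.
exact: (psi_mc.1 (Itv01 t0 t1) x y xE yE).
Qed.

Lemma psi_le X Y : E X -> E Y -> (\forall w \ae P, X w <= Y w) -> psi X <= psi Y.
Proof. exact: psi_mc.2. Qed.

Lemma bounded_in_E X : ae_bounded X -> E X.
Proof.
move=> [c Xc]; apply: (solid_ae E_solid (E_cst c)).
by move: Xc; apply: filterS.
Qed.

Lemma conj_Loo_leP Z (a : R) : intg Z -> (conj_Loo P psi Z <= a%:E)%E <->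
  forall X, ae_bounded X -> Ex (X \* Z) <= psi X + a.
Proof.
move=> iZ; split=> [Za X bX|Za].
  have : ('E_P[X \* Z] - (psi X)%:E <= a%:E)%E.
    by apply: le_trans Za; apply: ereal_sup_ubound; exists X => //; exact/LooP.
  rewrite unlock EFin_Ex; last exact: bounded_intgM.
  by rewrite -EFinB lee_fin lerBlDl addrC.
apply: ge_ereal_sup => _ [X /LooP bX <-].
rewrite unlock EFin_Ex; last exact: bounded_intgM.
by rewrite -EFinB lee_fin lerBlDl Za.
Qed.

Lemma dom_intg Z : dom psi Z -> intg Z.
Proof. by move=> [/L1P]. Qed.

Definition alpha Z : R := fine (conj_Loo P psi Z).

Lemma alphaE Z : dom psi Z -> conj_Loo P psi Z = (alpha Z)%:E.
Proof.
move=> [/L1P iZ Zoo]; rewrite fineK// fin_numElt Zoo andbT.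
have : ('E_P[(cst 0%R : M) \* Z] - (psi (cst 0%R))%:E <= conj_Loo P psi Z)%E.
  by apply: ereal_sup_ubound; exists (cst 0) => //; exact/LooP/ae_bounded_cst.
apply: lt_le_trans; rewrite unlock EFin_Ex; last exact/bounded_intgM/iZ/ae_bounded_cst.
by rewrite -EFinB ltNyr.
Qed.

Lemma alpha_fenchel X Z : ae_bounded X -> dom psi Z ->
  Ex (X \* Z) <= psi X + alpha Z.
Proof.
move=> bX dZ; apply: (conj_Loo_leP _ (dom_intg dZ)).1 => //.
by rewrite alphaE.
Qed.

Lemma conj_le_dom Z (a : R) : intg Z -> (conj_Loo P psi Z <= a%:E)%E ->
  dom psi Z /\ alpha Z <= a.
Proof.
move=> iZ Za; have dZ : dom psi Z.
  by split; [exact/L1P|rewrite (le_lt_trans Za)// ltry].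
by split => //; rewrite -lee_fin -alphaE.
Qed.

Lemma alpha_ge Z : dom psi Z -> - psi (cst 0) <= alpha Z.
Proof.
move=> dZ; have := alpha_fenchel (ae_bounded_cst 0) dZ.
rewrite (_ : (_ \* Z) = fun=> 0) ?Ex_cst; first by rewrite addrC -lerBlDr sub0r.
by apply/funext => w; exact: mul0r.
Qed.

(** Testing [Z] against [- t 1_(Z < 0)] with [t] large. *)
Lemma dom_ge0 Z : dom psi Z -> \forall w \ae P, 0 <= Z w.
Proof.
move=> dZ; have iZ := dom_intg dZ.
pose A := [set w | Z w < 0].
have mA : measurable A by rewrite -[A]setTI; exact: measurable_fun_ltr.
pose I := indic_mfun A mA : M.
have bI : ae_bounded I.
  exists 1; apply: aeW => w; rewrite /I /= /mindic indicE.
  by case: (_ \in _); rewrite ?normr1// normr0.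
have I0 w : 0 <= I w by rewrite /I /= /mindic indicE.
have iIZ := bounded_intgM bI iZ.
have IZ0 w : I w * Z w <= 0.
  rewrite /I /= /mindic indicE; case: (boolP (w \in A)) => wA.
    by rewrite mul1r ltW//; rewrite inE in wA.
  by rewrite mul0r.
have key t : 0 <= t -> - t * Ex (I \* Z) <= psi (cst 0) + alpha Z.
  move=> t0; have := intgM_comb (- t) 0 iIZ iIZ.
  rewrite scale0r addr0 mul0r addr0 => -[_ <-].
  have bI' : ae_bounded (- t *: I).
    by have := ae_bounded_comb (- t) 0 bI bI; rewrite scale0r addr0.
  apply: (le_trans (alpha_fenchel bI' dZ)); rewrite lerD2r; apply: psi_le => //.
  - exact: bounded_in_E.
  - apply: aeW => w; rewrite !mfE mulNr oppr_le0; exact: mulr_ge0.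
have EIZ : Ex (I \* Z) = 0.
  apply/eqP; rewrite eq_le; apply/andP; split.
    rewrite -oppr_ge0 -mulN1r -ExZ//; apply: Rintegral_ge0 => w _.
    by rewrite mulN1r oppr_ge0; exact: IZ0.
  rewrite leNgt; apply/negP => EIZ.
  have c0 : 0 <= psi (cst 0) + alpha Z by have := alpha_ge dZ; lra.
  have := key ((psi (cst 0) + alpha Z + 1) / - Ex (I \* Z)).
  rewrite mulNr -mulrN divfK ?oppr_eq0 ?lt_eqF//.
  have : 0 <= (psi (cst 0) + alpha Z + 1) / - Ex (I \* Z).
    by rewrite divr_ge0// ?oppr_ge0 ?(ltW EIZ)//; lra.
  by move=> /[swap] /[apply]; lra.
have : \forall w \ae P, - (I w * Z w) = 0.
  apply: (ae_Ex0 (f := fun w => - (I \* Z) w)); first exact: intgN.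
    by apply: aeW => w; rewrite oppr_ge0; exact: IZ0.
  under eq_Rintegral do rewrite -mulN1r.
  by rewrite ExZ// EIZ mulr0.
apply: filterS => w; rewrite /I /= /mindic indicE; case: (boolP (w \in A)) => wA.
  by rewrite mul1r => /eqP; rewrite oppr_eq0 => /eqP ->.
by rewrite notin_setE in wA; move: wA => /negP; rewrite -leNgt.
Qed.

(** Monotonicity passes the inequality from the bounded truncations [min V n] to
    [V]. A [V] unbounded from below cannot be reached in this way: there
    continuity of [psi] from above is needed. *)
Lemma fenchel V Z : E V -> (\forall w \ae P, 0 <= V w) -> dom psi Z ->
  intg (V \* Z) /\ Ex (V \* Z) <= psi V + alpha Z.
Proof.
move=> EV V0 dZ; have Z0 := dom_ge0 dZ; have iZ := dom_intg dZ.
pose Vn n : M := min_mfun V (cst n%:R).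
have Vn0 n : \forall w \ae P, 0 <= Vn n w.
  by move: V0; apply: filterS => w Vw; rewrite /Vn mfE le_min Vw/=.
have bVn n : ae_bounded (Vn n).
  exists n%:R; move: (Vn0 n); apply: filterS => w Vw.
  by rewrite ger0_norm// /Vn mfE ge_min lexx orbT.
have le1 n : Ex (Vn n \* Z) <= psi V + alpha Z.
  apply: (le_trans (alpha_fenchel (bVn n) dZ)); rewrite lerD2r; apply: psi_le => //.
    exact: bounded_in_E.
  by apply: aeW => w; rewrite /Vn mfE ge_min lexx.
have [] := @ae_fatou_integral _ _ _ P (fun n => Vn n \* Z) (V \* Z) (psi V + alpha Z) => //.
- apply: aeW => w; apply: cvg_near_cst.
  near=> n; rewrite -[LHS]/(Vn n w * Z w) /Vn mfE min_l//.
  rewrite (le_trans (ler_norm _))// ltW//.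
  near: n; exact: nbhs_infty_gtr.
- by move=> n; move: (Vn0 n) Z0; apply: filterS2 => w; exact: mulr_ge0.
- by move=> n; rewrite EFin_Ex ?lee_fin//; exact: bounded_intgM.
- move=> VZ0 VZle; have iVZ := ge0_intg (measurable_funPT (V \* Z)) VZ0 VZle.
  by split => //; rewrite -lee_fin -EFin_Ex.
Unshelve. all: by end_near. Qed.

Lemma dom_intgM V Z : E V -> dom psi Z -> intg (V \* Z).
Proof.
move=> EV dZ; pose Va : M := max_mfun V (- V).
have VaE w : Va w = `|V w|.
  by rewrite /Va !mfE; case: (ger0P (V w)) => V0; case: (ltP (V w) (- V w)); lra.
have EVa : E Va by apply: (solid_le E_solid EV) => w; rewrite VaE normr_id.
have [|iVa _] := fenchel EVa _ dZ; first by apply: aeW => w; rewrite VaE.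
apply: (ae_le_intg (g := fun w => `|(Va \* Z) w|)) => //; last exact: intg_norm.
by apply: aeW => w; rewrite -[(Va \* Z) w]/(Va w * Z w) VaE !normrM normr_id.
Qed.

Lemma dual_valueE X Z : E X -> dom psi Z ->
  dual_value (P := P) psi X Z = (Ex (X \* Z) - alpha Z)%:E.
Proof.
move=> EX dZ; rewrite /dual_value unlock EFin_Ex; last exact: dom_intgM.
by rewrite alphaE// EFinB.
Qed.

End conjugate.

(** * A compactness principle for bounded convex sets *)

Section common_point.
Context d {T : measurableType d} {R : realType} (P : probability T R).
Local Notation M := {mfun T >-> R}.
Local Notation intg f := (P.-integrable setT (EFin \o f)).
Local Notation Ex f := (Rintegral P setT f).
Implicit Types (X Y : M) (C : nat -> set M).

Let N (X : M) := Ex (fun w => X w ^+ 2).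

Let mid (X Y : M) : M := 2^-1 *: X + 2^-1 *: Y.

Let bounded_intg2 X Y (K : R) : (\forall w \ae P, `|X w| <= K) ->
  (\forall w \ae P, `|Y w| <= K) -> intg (fun w => X w * Y w).
Proof.
move=> XK YK; apply: (bounded_intgM (P := P) (X := X) (Z := Y)); first by exists K.
exact: bounded_intg YK.
Qed.

Let parallelogram X Y (K : R) : (\forall w \ae P, `|X w| <= K) ->
  (\forall w \ae P, `|Y w| <= K) ->
  intg (fun w => (Y w - X w) ^+ 2) /\
  Ex (fun w => (Y w - X w) ^+ 2) = 2 * N X + 2 * N Y - 4 * N (mid X Y).
Proof.
move=> XK YK.
have iXX := bounded_intg2 XK XK; have iYY := bounded_intg2 YK YK.
have iXY := bounded_intg2 XK YK.
have i1 : intg (fun w => X w * X w + Y w * Y w) by exact: intgD.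
have i2 : intg (fun w => 2 * (X w * Y w)) by exact: intgZ.
have NE Z : N Z = Ex (fun w => Z w * Z w) by [].
have E1 : (fun w => (Y w - X w) ^+ 2) =
    (fun w => (X w * X w + Y w * Y w) - 2 * (X w * Y w)).
  by apply/funext => w; ring.
have E2 : (fun w => mid X Y w * mid X Y w) =
    (fun w => 4^-1 * ((X w * X w + Y w * Y w) + 2 * (X w * Y w))).
  by apply/funext => w; rewrite /mid !mfE; field.
rewrite (NE X) (NE Y) (NE (mid X Y)) E1 E2; split; first exact: intgB.
rewrite ExZ; last exact: intgD.
by rewrite ExB// !ExD// ExZ//; field.
Qed.

(** Almost minimizers of the [L^2] norm in the sets [C n] form a Cauchy sequence
    by the parallelogram identity, so no weak compactness is needed. *)
Lemma decreasing_convex_common_point C (K : R) :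
  (forall n X, C n X -> \forall w \ae P, `|X w| <= K) ->
  (forall n, C n !=set0) ->
  (forall n, C n.+1 `<=` C n) ->
  (forall n X Y, C n X -> C n Y -> C n (2^-1 *: X + 2^-1 *: Y)) ->
  (forall n (X_ : nat -> M) X, (forall i, C n (X_ i)) ->
     (\forall w \ae P, X_ i w @[i --> \oo] --> X w) -> C n X) ->
  exists X, forall n, C n X.
Proof.
move=> CK C0 Cdecr Cmid Cclosed.
have Cle m n : (m <= n)%N -> C n `<=` C m.
  move=> /subnK <-; elim: (n - m)%N => // k IH x.
  by rewrite addSn => /Cdecr; exact: IH.
have N0 X : 0 <= N X by apply: Rintegral_ge0 => w _; exact: sqr_ge0.
have NK n X : C n X -> N X <= K ^+ 2.
  move=> CX; rewrite -[leRHS](Ex_cst P); apply: ae_le_Ex.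
  - exact: (bounded_intg2 (CK _ _ CX) (CK _ _ CX)).
  - exact: intg_cst.
  - move: (CK _ _ CX); apply: filterS => w XK.
    by rewrite -real_normK ?num_real// lerXn2r ?nnegrE// (le_trans _ XK).
pose m n := inf (N @` C n).
have NC0 n : N @` C n !=set0 by have [X CX] := C0 n; exists (N X), X.
have NClb n : has_lbound (N @` C n) by exists 0 => _ [X _ <-].
have mle n X : C n X -> m n <= N X.
  by move=> CX; apply: ge_inf => //; exists X.
have mK n : m n <= K ^+ 2.
  by have [X CX] := C0 n; apply: (le_trans (mle _ _ CX)); exact: NK CX.
have hsm : has_sup (range m).
  by split; [exists (m 0%N), 0%N|exists (K ^+ 2) => _ [n _ <-]].
pose S := sup (range m).
have mS n : m n <= S by apply: ub_le_sup; [exact: hsm.2|exists n].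
have m_mono i j : (i <= j)%N -> m i <= m j.
  move=> ij; apply: lb_le_inf => // _ [X CX <-]; apply: mle.
  exact: Cle CX.
(* With this slack the parallelogram identity bounds the squared distance of
   consecutive points by [(2^-j)^2]. *)
pose del j : R := (2^-1 ^+ j) ^+ 2 / 8.
have del0 j : 0 < del j by rewrite divr_gt0// !exprn_gt0// invr_gt0.
have /choice[ny Hny] : forall j, exists ny : nat * M,
    [/\ (j <= ny.1)%N, S - del j <= m ny.1, C ny.1 ny.2 & N ny.2 <= S + del j].
  move=> j; have [_ [n _ <-] Sn] := sup_adherent (del0 j) hsm.
  pose n' := maxn j n.
  have /(inf_adherent (del0 j))[_ [Y CY <-] NY] : has_inf (N @` C n') by [].
  exists (n', Y); split => //=.
  - exact: leq_maxl.
  - by rewrite (le_trans (ltW Sn))// m_mono// leq_maxr.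
  - by rewrite (le_trans (ltW NY))// lerD2r; exact: mS.
pose y j := (ny j).2.
have yC j n : (n <= j)%N -> C n (y j).
  move=> nj; have [jn _ Cy _] := Hny j.
  by apply: Cle Cy; exact: leq_trans jn.
have yK j : \forall w \ae P, `|y j w| <= K by apply: (CK 0%N); exact: yC.
have iy j : intg (y j) by exact: bounded_intg (yK j).
have dely j : del j.+1 <= del j.
  rewrite /del ler_pM2r ?invr_gt0// -!exprM ler_wiXn2l//; first by lra.
  by rewrite leq_mul2r leqnSn orbT.
have dy j : Ex (fun w => `|y j.+1 w - y j w|) <= 2^-1 ^+ j.
  have [i2 E2] := parallelogram (yK j) (yK j.+1).
  pose e : R := 2^-1 ^+ j.
  have e0 : 0 < e by rewrite exprn_gt0// invr_gt0.
  have bound : Ex (fun w => (y j.+1 w - y j w) ^+ 2) <= e ^+ 2.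
    rewrite E2.
    have [jn Sm Cy Ny] := Hny j; have [jn1 Sm1 Cy1 Ny1] := Hny j.+1.
    pose n := minn (ny j).1 (ny j.+1).1.
    have Cm : C n (mid (y j) (y j.+1)).
      by apply: Cmid; [apply: Cle Cy|apply: Cle Cy1]; rewrite ?geq_minl ?geq_minr.
    have Sn : S - del j <= m n.
      rewrite /n; case: (leqP (ny j).1 (ny j.+1).1) => _ //.
      by apply: le_trans Sm1; rewrite lerD2l lerN2.
    have := le_trans Sn (mle _ _ Cm).
    have := dely j.
    have -> : e ^+ 2 = 8 * del j by rewrite /del -/e; field.
    by move: Ny Ny1; rewrite -/(y j) -/(y j.+1); lra.
  have iD : intg (fun w => `|y j.+1 w - y j w|) by apply/intg_norm/intgB.
  have i3 : intg (fun w => e / 2 + (2 * e)^-1 * (y j.+1 w - y j w) ^+ 2).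
    by apply: intgD; [exact: intg_cst|exact: intgZ].
  apply: (le_trans (ae_le_Ex iD i3 _)).
    apply: aeW => w; set u := y j.+1 w - y j w.
    have -> : e / 2 + (2 * e)^-1 * u ^+ 2 = (2 * e)^-1 * (e ^+ 2 + u ^+ 2).
      by field; lra.
    rewrite ler_pdivlMl ?mulr_gt0// -[u ^+ 2]real_normK ?num_real//.
    have : 0 <= (`|u| - e) ^+ 2 by exact: sqr_ge0.
    rewrite sqrrB expr2; lra.
  rewrite ExD; [|exact: intg_cst|exact: intgZ].
  rewrite Ex_cst ExZ// -/e.
  have : (2 * e)^-1 * Ex (fun w => (y j.+1 w - y j w) ^+ 2) <= (2 * e)^-1 * e ^+ 2.
    by rewrite ler_pM2l// invr_gt0 mulr_gt0.
  have -> : (2 * e)^-1 * e ^+ 2 = e / 2 by field; lra.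
  lra.
have ycvg := summable_Ex_ae_cvg iy dy.
pose lim_y w := fine (limn_esup (fun n => (y n w)%:E)).
have mlim : measurable_fun setT lim_y.
  apply: measurableT_comp => //; apply: measurable_fun_limn_esup => n.
  exact/measurable_EFinP.
pose Y : M := HB.pack lim_y (isMeasurableFun.Build _ _ _ _ lim_y mlim).
have yY : \forall w \ae P, y j w @[j --> \oo] --> Y w.
  move: ycvg; apply: filterS => w /cvg_ex[/= l yl].
  have yl' : (fun n => (y n w)%:E) @ \oo --> l%:E by exact/cvg_EFin/yl/nearW.
  have Yl : Y w = l.
    by rewrite -[Y w]/(lim_y w) /lim_y; have [_ ->] := cvg_limn_einf_sup yl'.
  by move: yl; rewrite -Yl.
exists Y => n; apply: (Cclosed n (fun i => y (i + n)%N)) => [i|].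
  by apply: yC; exact: leq_addl.
move: yY; apply: filterS => w yw.
by rewrite (cvg_shiftn n (fun i => y i w)).
Qed.

End common_point.

(** * Duality on bounded random variables *)

Section bounded_duality.
Context d {T : measurableType d} {R : realType} (P : probability T R).
Local Notation M := {mfun T >-> R}.
Local Notation intg f := (P.-integrable setT (EFin \o f)).
Local Notation Ex f := (Rintegral P setT f).
Local Notation dom := (@dom_conj_Loo d T R P).
Implicit Types (X Y Z V : M).
Variables (E : set M) (psi : M -> R).
Hypothesis E_solid : solid_space P E.
Hypothesis E_cst : contains_constants P E.
Hypothesis psi_mc : monotone_convex P E psi.
Hypothesis psi_fatou : fatou_property P E psi.
Let sE := solid_subspace E_solid.

Let half01 : (0 : R) <= (2^-1 : R) <= (1 : R). Proof. lra. Qed.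
Let halfC : 1 - 2^-1 = 2^-1 :> R. Proof. lra. Qed.
Let compl_ge0 (t : R) : 0 <= t <= 1 -> 0 <= 1 - t.
Proof. by move=> /andP[_]; rewrite subr_ge0. Qed.

Let combD3 (t p p1 p2 q q1 q2 r r1 r2 a : R) : 0 <= t <= 1 ->
  p <= t * p1 + (1 - t) * p2 -> q <= t * q1 + (1 - t) * q2 ->
  r <= t * r1 + (1 - t) * r2 ->
  p1 + q1 + r1 <= a -> p2 + q2 + r2 <= a -> p + q + r <= a.
Proof.
move=> /[dup] t01 /andP[t0 _] hp hq hr h1 h2.
have := ler_wpM2l t0 h1; have := ler_wpM2l (compl_ge0 t01) h2; lra.
Qed.

Let combD2 (t p p1 p2 q q1 q2 a1 a2 e : R) : 0 <= t <= 1 ->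
  p <= t * p1 + (1 - t) * p2 -> q <= t * q1 + (1 - t) * q2 ->
  p1 + q1 < a1 + e -> p2 + q2 < a2 + e ->
  p + q <= t * a1 + (1 - t) * a2 + e.
Proof.
move=> /[dup] t01 /andP[t0 _] hp hq h1 h2.
have := ler_wpM2l t0 (ltW h1); have := ler_wpM2l (compl_ge0 t01) (ltW h2); lra.
Qed.

Let lower_bound (a p p1 p2 q q1 : R) : a < p + q ->
  p <= 2^-1 * p1 + (1 - 2^-1) * p2 -> q <= 2^-1 * q1 + (1 - 2^-1) * 0 ->
  2 * a - p2 <= p1 + q1.
Proof. lra. Qed.

Let scaled_comb (t r x y z : R) : 0 <= r -> z <= t * x + (1 - t) * y ->
  r * z <= t * (r * x) + (1 - t) * (r * y).
Proof. by move=> r0 /(ler_wpM2l r0); rewrite mulrDr (mulrCA r t) (mulrCA r (1 - t)). Qed.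

Let bounded_multiples_le0 (x c : R) : (forall t, 0 <= t -> t * x <= c) -> x <= 0.
Proof.
move=> xc; rewrite leNgt; apply/negP => x0.
have c0 : 0 <= c by have := xc 0 (lexx _); rewrite mul0r.
have t0 : 0 <= (c + 1) / x by rewrite divr_ge0 ?(ltW x0)//; lra.
by have := xc _ t0; rewrite divfK ?gt_eqF//; lra.
Qed.

Lemma fatou_le (X_ : nat -> M) X (u : nat -> R) (l : R) :
  dominated_ae_cvg (P := P) E X_ X -> (forall n, psi (X_ n) <= u n) ->
  u @ \oo --> l -> psi X <= l.
Proof.
move=> XX psiu ul; rewrite leNgt; apply/negP => lpsi.
have lm : l < (l + psi X) / 2 by lra.
have mpsi : (l + psi X) / 2 < psi X by lra.
have : (((l + psi X) / 2)%:E < limn_einf (fun n => (psi (X_ n))%:E))%E.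
  by apply: lt_le_trans (psi_fatou XX); rewrite lte_fin.
move=> /lt_limn_einf h1.
have h2 : \forall n \near \oo, u n < (l + psi X) / 2 by exact: cvgr_lt ul _ _.
near \oo => n.
have : u n < (l + psi X) / 2 by near: n.
have : ((l + psi X) / 2 < psi (X_ n))%R by rewrite -lte_fin; near: n.
by have := psiu n; lra.
Unshelve. all: by end_near. Qed.

Let exc (i : nat) Y : M := max_mfun (Y - cst i%:R) (cst 0).

Let excE i Y w : exc i Y w = Num.max (Y w - i%:R) 0. Proof. by []. Qed.

Let exc_ge0 i Y w : 0 <= exc i Y w. Proof. by rewrite excE le_max lexx orbT. Qed.

(** The slope of the penalty jumps by [c i] at the height [i]; only the heights
    below [k] matter for a [Y] that is bounded by [k]. *)
Let pen (c : nat -> R) k Y := \sum_(i < k) c i * Ex (exc i Y).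

Let within (k : nat) Y := \forall w \ae P, 0 <= Y w <= k%:R.

Let within_bounded k Y : within k Y -> ae_bounded P Y.
Proof.
move=> Yk; exists k%:R; move: Yk; apply: filterS => w /andP[Y0 Yk].
by rewrite ger0_norm.
Qed.

Let within_le k m Y : (k <= m)%N -> within k Y -> within m Y.
Proof.
move=> km; apply: filterS => w /andP[-> /le_trans->]//=.
by rewrite ler_nat.
Qed.

Let within_comb k (t : R) X Y : 0 <= t <= 1 -> within k X -> within k Y ->
  within k (t *: X + (1 - t) *: Y).
Proof.
move=> /andP[t0 t1]; apply: filterS2 => w /andP[X0 Xk] /andP[Y0 Yk].
rewrite !mfE; have t1' : 0 <= 1 - t by lra.
have := ler_wpM2l t0 Xk; have := ler_wpM2l t1' Yk.
have := mulr_ge0 t0 X0; have := mulr_ge0 t1' Y0; lra.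
Qed.

Let exc_bound i k Y : within k Y -> \forall w \ae P, `|exc i Y w| <= k%:R.
Proof.
apply: filterS => w /andP[Y0 Yk]; rewrite ger0_norm// excE ge_max.
by rewrite ler0n andbT (le_trans _ Yk)// gerBl ler0n.
Qed.

Let exc_intg i k Y : within k Y -> intg (exc i Y).
Proof. by move=> /(exc_bound i); exact: bounded_intg. Qed.

Let Eexc_ge0 i Y : 0 <= Ex (exc i Y).
Proof. by apply: Rintegral_ge0 => w _; exact: exc_ge0. Qed.

Let exc_convex i k (t : R) X Y : 0 <= t <= 1 -> within k X -> within k Y ->
  Ex (exc i (t *: X + (1 - t) *: Y)) <= t * Ex (exc i X) + (1 - t) * Ex (exc i Y).
Proof.
move=> t01 Xk Yk; have iX := exc_intg i Xk; have iY := exc_intg i Yk.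
have /andP[t0 t1] := t01; have t1' := compl_ge0 t01.
rewrite -!ExZ// -ExD; [|exact: intgZ|exact: intgZ].
apply: ae_le_Ex.
- exact: exc_intg (within_comb t01 Xk Yk).
- by apply: intgD; exact: intgZ.
- apply: aeW => w.
  suff : exc i (t *: X + (1 - t) *: Y) w <= t * exc i X w + (1 - t) * exc i Y w by [].
  have lX : X w - i%:R <= exc i X w by rewrite excE le_max lexx.
  have lY : Y w - i%:R <= exc i Y w by rewrite excE le_max lexx.
  rewrite excE; move: (exc_ge0 i X w) (exc_ge0 i Y w) lX lY.
  move: (exc i X w) (exc i Y w) => x y x0 y0 lX lY.
  rewrite !mfE ge_max addr_ge0 ?mulr_ge0// andbT.
  have := ler_wpM2l t0 lX; have := ler_wpM2l t1' lY; lra.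
Qed.

Let exc_above i k Y : (k <= i)%N -> within k Y -> Ex (exc i Y) = 0.
Proof.
move=> ki Yk; rewrite -[RHS](Ex_cst P); apply: ae_eq_Ex => //.
move: Yk; apply: filterS => w /andP[Y0 Yk]; rewrite excE max_r// subr_le0.
by rewrite (le_trans Yk)// ler_nat.
Qed.

Let exc_cvg i k (Y_ : nat -> M) Y : (forall n, within k (Y_ n)) ->
  (\forall w \ae P, Y_ n w @[n --> \oo] --> Y w) ->
  Ex (exc i (Y_ n)) @[n --> \oo] --> Ex (exc i Y).
Proof.
move=> Yk YY; apply: (ae_dominated_Ex_cvg (g := fun=> k%:R)) => //.
- move: YY; apply: filterS => w YY.
  have maxE (x : R) : Num.max (x - i%:R) 0 = (x - i%:R + `|x - i%:R|) / 2.
    by rewrite maxr_absE subr0 addr0.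
  rewrite excE maxE; under eq_fun do rewrite excE maxE.
  have YYi := cvgB_seq YY (cvg_cst_seq i%:R).
  apply: cvgMr_tmp; exact: (cvgD_seq YYi (cvg_norm_seq YYi)).
- by move=> n; exact: exc_bound.
- exact: intg_cst.
Qed.

Let within_cvg k (Y_ : nat -> M) Y : (forall n, within k (Y_ n)) ->
  (\forall w \ae P, Y_ n w @[n --> \oo] --> Y w) -> within k Y.
Proof.
move=> Yk; move: (ae_foralln Yk); apply: filterS2 => w {}Yk YY.
have cY : cvgn (fun n => Y_ n w) by apply/cvg_ex; exists (Y w).
rewrite -(cvg_lim _ YY)//; apply/andP; split.
  by apply: limr_ge => //; apply: nearW => n; case/andP: (Yk n).
by apply: limr_le => //; apply: nearW => n; case/andP: (Yk n).
Qed.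

Let pen_widen c k m Y : (k <= m)%N -> within k Y -> pen c m Y = pen c k Y.
Proof.
move=> km Yk; rewrite /pen -(subnKC km) big_split_ord /=.
rewrite [X in _ + X]big1 ?addr0// => i _.
by rewrite (exc_above _ Yk) ?mulr0//= leq_addr.
Qed.

Let pen_convex c k m (t : R) X Y : (forall i, 0 <= c i) -> 0 <= t <= 1 ->
  within k X -> within k Y ->
  pen c m (t *: X + (1 - t) *: Y) <= t * pen c m X + (1 - t) * pen c m Y.
Proof.
move=> c0 t01 Xk Yk; rewrite /pen !mulr_sumr -big_split; apply: ler_sum => i _ /=.
exact: (scaled_comb (c0 i) (exc_convex i t01 Xk Yk)).
Qed.

Let pen_cvg c m k (Y_ : nat -> M) Y : (forall n, within k (Y_ n)) ->
  (\forall w \ae P, Y_ n w @[n --> \oo] --> Y w) ->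
  pen c m (Y_ n) @[n --> \oo] --> pen c m Y.
Proof.
move=> Yk YY; rewrite /pen; elim: m => [|m IH].
  by under eq_fun do rewrite big_ord0; rewrite big_ord0; exact: cvg_cst_seq.
under eq_fun do rewrite big_ord_recr/=; rewrite big_ord_recr/=.
apply: (cvgD_seq IH); apply: cvgZ_seq; exact: (exc_cvg Yk YY).
Qed.

Variables (X : M) (a : R).
Hypotheses (bX : ae_bounded P X) (aX : a < psi X).

Let EB V : ae_bounded P V -> E V.
Proof. exact: (bounded_in_E E_solid E_cst). Qed.

Let bXB k Y : within k Y -> ae_bounded P (X - Y).
Proof.
move=> Yk; have := ae_bounded_comb 1 (-1) bX (within_bounded Yk).
by rewrite scale1r scaleN1r.
Qed.

Let cap (c : nat -> R) k := forall Y, within k Y -> a < psi (X - Y) + pen c k Y.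

Let psi_convexW (t : R) V V' : 0 <= t <= 1 -> ae_bounded P V -> ae_bounded P V' ->
  psi (t *: V + (1 - t) *: V') <= t * psi V + (1 - t) * psi V'.
Proof. by move=> t01 bV bV'; apply: (psi_convex psi_mc) => //; exact: EB. Qed.

(** If no slope at the height [k] were steep enough, the sets below would have a
    common point, which could not exceed [k]. *)
Let cap_step c k : (forall i, 0 <= c i) -> cap c k ->
  exists2 x : R, 0 <= x &
    forall Y, within k.+1 Y -> a < psi (X - Y) + pen c k Y + x * Ex (exc k Y).
Proof.
move=> c0 capk; apply: contrapT => noX.
have {noX} noX (n : nat) : exists Y, within k.+1 Y /\
    psi (X - Y) + pen c k Y + n%:R * Ex (exc k Y) <= a.
  apply: contrapT => noY; apply: noX; exists n%:R => // Y Yk.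
  by rewrite ltNge; apply/negP => ?; apply: noY; exists Y.
pose C n := [set Y | within k.+1 Y /\
    psi (X - Y) + pen c k Y + n%:R * Ex (exc k Y) <= a].
have [|||||Y CY] := @decreasing_convex_common_point _ _ _ P C k.+1%:R.
- move=> n Y [+ _]; apply: filterS => w /andP[Y0 Yk].
  by rewrite ger0_norm.
- exact: noX.
- move=> n Y [Yk Yn]; split => //; apply: le_trans Yn; rewrite lerD2l.
  by rewrite ler_wpM2r// ler_nat.
- move=> n Y Y' [Yk Yn] [Yk' Yn'].
  rewrite -[X in _ + X *: _]halfC; split; first exact: within_comb.
  have -> : X - (2^-1 *: Y + (1 - 2^-1) *: Y') =
      2^-1 *: (X - Y) + (1 - 2^-1) *: (X - Y').
    by rewrite conv_translate !scalerN opprD.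
  apply: (combD3 half01 _ _ _ Yn Yn').
  - exact: (psi_convexW half01 (bXB Yk) (bXB Yk')).
  - exact: (pen_convex k c0 half01 Yk Yk').
  - exact: (scaled_comb (ler0n R n) (exc_convex k half01 Yk Yk')).
- move=> n Y_ Y CY_ YY.
  have Yk i : within k.+1 (Y_ i) by case: (CY_ i).
  have Yk' := within_cvg Yk YY; split => //.
  pose u i := a - (pen c k (Y_ i) + n%:R * Ex (exc k (Y_ i))).
  have uc : u @ \oo --> a - (pen c k Y + n%:R * Ex (exc k Y)).
    apply: (cvgB_seq (cvg_cst_seq a)).
    apply: (cvgD_seq (pen_cvg Yk YY)); apply: cvgZ_seq.
    exact: (exc_cvg Yk YY).
  have domX : dominated_ae_cvg (P := P) E (fun i => X - Y_ i) (X - Y).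
    split.
    - by move=> i; apply: EB; exact: bXB (Yk i).
    - have [c1 Xc1] := bX; exists (cst (`|c1| + k.+1%:R)); split.
      + exact: E_cst.
      + by apply: aeW => w; rewrite mfE addr_ge0.
      + move=> i; move: Xc1 (Yk i); apply: filterS2 => w Xc1 /andP[Y0 Y1].
        rewrite !mfE (le_trans (ler_normB _ _))// lerD//.
          by rewrite (le_trans Xc1)// ler_norm.
        by rewrite ger0_norm.
    - move: YY; apply: filterS => w YY.
      exact: (cvgB_seq (cvg_cst_seq (X w)) YY).
  rewrite -addrA -lerBrDr; apply: fatou_le domX _ uc => i.
  by rewrite /u lerBrDr addrA; case: (CY_ i).
have [Yk1 Y0] := CY 0%N.
have Eexc0 : Ex (exc k Y) = 0.
  apply/eqP; rewrite eq_le Eexc_ge0 andbT.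
  apply: (@bounded_multiples_le0 _ (a - (psi (X - Y) + pen c k Y))) => t t0.
  have [_] := CY (Num.truncn t).+1; rewrite -lerBrDl; apply: le_trans.
  by rewrite ler_wpM2r// ltW// truncnS_gt.
have Yk : within k Y.
  have := ae_Ex0 (exc_intg k Yk1) _ Eexc0.
  have -> : (\forall w \ae P, 0 <= exc k Y w) = True.
    by apply/propext; split => // _; exact: aeW.
  move=> /(_ I); move: Yk1; apply: filterS2 => w /andP[Y0' _] exc0.
  have : Y w - k%:R <= exc k Y w by rewrite excE le_max lexx.
  by rewrite exc0 subr_le0 Y0'.
by have := capk _ Yk; move: Y0; rewrite mul0r addr0 leNgt => /negP.
Qed.

Let slopes : exists2 c : nat -> R, (forall i, 0 <= c i) & forall k, cap c k.
Proof.
pose good c k (x : R) := 0 <= x /\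
    forall Y, within k.+1 Y -> a < psi (X - Y) + pen c k Y + x * Ex (exc k Y).
pose next (s : seq R) := xget 0 (good (nth 0 s) (size s)).
pose l := fix l n := if n is m.+1 then rcons (l m) (next (l m)) else [::].
have size_l n : size (l n) = n by elim: n => //= n IH; rewrite size_rcons IH.
pose c i := next (l i).
have nth_l n i : (i < n)%N -> nth 0 (l n) i = c i.
  elim: n => // n IH; rewrite ltnS leq_eqVlt => /predU1P[->|iltn] /=.
    by rewrite nth_rcons size_l ltnn eqxx.
  by rewrite nth_rcons size_l iltn IH.
have penE n Y : pen (nth 0 (l n)) n Y = pen c n Y.
  by apply: eq_bigr => i _; rewrite nth_l.
have nth0 n : (forall i, (i < n)%N -> 0 <= c i) -> forall i, 0 <= nth 0 (l n) i.
  move=> cn i; have [iltn|ni] := ltnP i n; first by rewrite nth_l// cn.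
  by rewrite nth_default// size_l.
have main n : (forall i, (i < n)%N -> 0 <= c i) /\ cap c n.
  elim: n => [|n [c0 capn]].
    split => // Y Y0; rewrite /pen big_ord0 addr0.
    apply: (lt_le_trans aX); apply: (psi_le psi_mc).
    - exact: EB.
    - by apply: EB; exact: bXB Y0.
    - move: Y0; apply: filterS => w /andP[_ Y0].
      by rewrite !mfE lerBrDr gerDl.
  have [|x x0 Hx] := @cap_step (nth 0 (l n)) n (nth0 _ c0).
    by move=> Y Yn; rewrite penE; exact: capn.
  have : good (nth 0 (l n)) (size (l n)) (c n).
    by apply: xgetPex; exists x; rewrite size_l.
  rewrite size_l => -[cn0 Hcn]; split.
    by move=> i; rewrite ltnS leq_eqVlt => /predU1P[->|/c0].
  move=> Y Yn; have := Hcn _ Yn.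
  by rewrite penE /pen big_ord_recr/= addrA.
exists c => [i|k]; last by case: (main k).
by have [H _] := main i.+1; exact: H.
Qed.

(** The infimal convolution of [psi] and the penalty still exceeds [a] at [X];
    its subgradients there are dominated by the penalty, hence countably
    additive. *)
Lemma bounded_duality : exists2 Z, dom psi Z & a <= Ex (X \* Z) - alpha P psi Z.
Proof.
have [c c0 capc] := slopes.
pose B : set M := ae_bounded P.
have B_solid : solid_space P B := bounded_solid P.
have sB := solid_subspace B_solid.
have B_cst : contains_constants P B := fun c => ae_bounded_cst P c.
pose S V := [set psi (X + V - p.2) + pen c p.1 p.2 | p in
  [set p : nat * M | within p.1 p.2]].
have w00 : within 0 (0 : M) by apply: aeW => w; rewrite mfE lexx.
have S0 V : S V !=set0 by exists (psi (X + V - 0) + pen c 0 0), (0%N, 0).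
have bXV V : B V -> B (X + V) by move=> BV; exact: vector_subspaceD.
have bXVY V k Y : B V -> within k Y -> B (X + V - Y).
  by move=> BV Yk; apply: (vector_subspaceB sB); [exact: bXV|exact: within_bounded Yk].
(* The points [V] and [- V] average to [0], where the penalized values exceed [a]. *)
have Slb V : B V -> has_lbound (S V).
  move=> BV; exists (2 * a - psi (X - V)) => _ [[k Y] /= Yk <-].
  have wY : within k (2^-1 *: Y + (1 - 2^-1) *: 0).
    by apply: within_comb => //; exact: within_le w00.
  have w0k : within k (0 : M) by exact: within_le w00.
  have {}wY := capc _ _ wY.
  have bV : B (X + (V - Y)) by rewrite addrA; exact: bXVY Yk.
  have bV' : B (X - V) by exact: vector_subspaceB.
  have psiY := psi_convexW half01 bV bV'.
  have penY := pen_convex k c0 half01 Yk w0k.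
  have pen0 : pen c k 0 = 0 by rewrite (pen_widen _ _ w00)// /pen big_ord0.
  have XE : X - (2^-1 *: Y + (1 - 2^-1) *: 0) =
      2^-1 *: (X + (V - Y)) + (1 - 2^-1) *: (X - V).
    rewrite conv_translate scaler0 addr0 scalerBr halfC.
    by rewrite scalerN addrAC subrr add0r.
  rewrite pen0 in penY; rewrite XE in wY; rewrite -addrA.
  exact: (lower_bound wY psiY penY).
pose h V := inf (S V).
have hle V k Y : B V -> within k Y -> h V <= psi (X + V - Y) + pen c k Y.
  by move=> BV Yk; apply: ge_inf; [exact: Slb|exists (k, Y)].
have h_convex : convex_on B h.
  move=> V V' t BV BV' t01; apply/ler_addgt0Pr => e e0.
  have /(inf_adherent e0)[_ [[k Y] /= Yk <-] hV] : has_inf (S V) by split; [|exact: Slb].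
  have /(inf_adherent e0)[_ [[k' Y'] /= Yk' <-] hV'] : has_inf (S V') by split; [|exact: Slb].
  pose m := maxn k k'.
  have Ym : within m Y by apply: within_le Yk; exact: leq_maxl.
  have Ym' : within m Y' by apply: within_le Yk'; exact: leq_maxr.
  have BVt : B (t *: V + (1 - t) *: V') by exact: sB.2.
  apply: (le_trans (hle _ _ _ BVt (within_comb t01 Ym Ym'))).
  have -> : X + (t *: V + (1 - t) *: V') - (t *: Y + (1 - t) *: Y') =
      t *: (X + V - Y) + (1 - t) *: (X + V' - Y').
    rewrite -(addrA X V) -(addrA X V') conv_translate !scalerBr.
    by rewrite addrACA -opprD [RHS]addrA.
  have psit := psi_convexW t01 (bXVY _ _ _ BV Yk) (bXVY _ _ _ BV' Yk').
  have pent := pen_convex m c0 t01 Ym Ym'.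
  rewrite (pen_widen c (leq_maxl k k') Yk) in pent.
  rewrite (pen_widen c (leq_maxr k k') Yk') in pent.
  exact: (combD2 t01 psit pent hV hV').
(* [h] is at most [psi (X + V)], whence [phi] is positive and [alpha Z] is bounded,
   and at most [psi X] plus the penalty of [V], whence [phi] is continuous. *)
have h0 : a <= h 0.
  by apply: lb_le_inf => // _ [[k Y] /= Yk <-]; rewrite addr0 ltW//; exact: capc.
have [phi phi_lin phi_h] := convex_subgradient sB h_convex sB.1.
have {}phi_h V : B V -> phi V <= h V - h 0.
  by move=> BV; have := phi_h _ BV; rewrite add0r.
have phiZ (t : R) V : B V -> phi (t *: V) = t * phi V.
  by move=> BV; have := phi_lin t 0 _ _ BV BV; rewrite scale0r mul0r !addr0.
have h_psi V : B V -> h V <= psi (X + V).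
  move=> BV; have := hle _ _ _ BV w00.
  by rewrite subr0 /pen big_ord0 addr0.
have phi_ge0 V : B V -> (\forall w \ae P, 0 <= V w) -> 0 <= phi V.
  move=> BV V0; rewrite -oppr_le0.
  apply: (@bounded_multiples_le0 _ (psi X - h 0)) => t t0.
  rewrite mulrN -mulNr -phiZ//.
  have BtV : B (- t *: V) by exact: vector_subspaceZ.
  apply: (le_trans (phi_h _ BtV)); rewrite lerD2r.
  apply: (le_trans (h_psi _ BtV)); apply: (psi_le psi_mc).
  - by apply: EB; exact: bXV.
  - exact: EB.
  - move: V0; apply: filterS => w V0.
    by rewrite !mfE gerDl mulNr oppr_le0 mulr_ge0.
have phi_cont (U_ : nat -> M) (Y : M) : B Y ->
    (forall n w, 0 <= U_ n w <= Y w) -> (forall w, U_ n w @[n --> \oo] --> 0) ->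
    phi (U_ n) @[n --> \oo] --> 0.
  move=> BY UY U0.
  have BU n : B (U_ n).
    apply: (solid_ae B_solid BY); apply: aeW => w.
    by have /andP[? ?] := UY n w; rewrite ger0_norm.
  have [K YK] := BY.
  apply/cvg_seqP => e e0; pose t := (psi X - h 0 + 1) / e.
  have c1 : 0 <= psi X - h 0.
    by rewrite subr_ge0; have := h_psi _ sB.1; rewrite addr0.
  have t0 : 0 < t by rewrite divr_gt0// ltr_wpDl.
  pose k := (Num.truncn (t * `|K|)).+1.
  have wU n : within k (t *: U_ n).
    move: YK; apply: filterS => w YK; have /andP[Uw0 UwY] := UY n w.
    rewrite mfE mulr_ge0 ?(ltW t0)//=; apply: le_trans (ltW (truncnS_gt _)).
    rewrite ler_wpM2l ?(ltW t0)// (le_trans UwY)// (le_trans (ler_norm _))//.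
    by rewrite (le_trans YK)// ler_norm.
  have pen0 : pen c k (t *: U_ n) @[n --> \oo] --> 0.
    have -> : 0 = pen c k (0 : M) by rewrite (pen_widen _ _ w00)// /pen big_ord0.
    apply: (@pen_cvg c k k (fun n => t *: U_ n) 0 wU); apply: aeW => w.
    by have := cvgZ_seq (c := t) (U0 w); rewrite mulr0.
  have [N HN] := (cvg_seqP _ _).1 pen0 1 ltr01.
  exists N => n Nn; rewrite subr0 ger0_norm; last first.
    by apply: phi_ge0 => //; apply: aeW => w; case/andP: (UY n w).
  rewrite -(ler_pM2l t0) -phiZ// /t divfK ?gt_eqF//.
  have BtU : B (t *: U_ n) by exact: vector_subspaceZ.
  apply: (le_trans (phi_h _ BtU)); rewrite addrAC lerD2r.
  apply: (le_trans (hle _ _ _ BtU (wU n))); rewrite addrK lerD2l.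
  by have := HN n Nn; rewrite subr0; apply: le_trans; exact: ler_norm.
have [Z [iZ Z0 phiE]] := order_continuous_representation B_solid B_cst phi_lin
  phi_ge0 phi_cont.
have [dZ aZ] : dom psi Z /\ alpha P psi Z <= Ex (X \* Z) - a.
  apply: conj_le_dom => //; apply/conj_Loo_leP => // W bW.
  have BWX : B (W - X) by exact: vector_subspaceB.
  have phiW : phi (W - X) <= psi W - a.
    apply: (le_trans (phi_h _ BWX)); apply: lerB => //.
    by have := h_psi _ BWX; rewrite [X + _]addrC subrK.
  have EWX' : phi (W - X) = Ex (W \* Z) - Ex (X \* Z).
    rewrite -(phiE W bW).2 -(phiE X bX).2.
    by have := phi_lin 1 (-1) _ _ bW bX; rewrite scale1r scaleN1r mul1r mulN1r.
  by rewrite EWX' in phiW; rewrite addrCA -lerBlDl.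
by exists Z => //; rewrite lerBrDl -lerBrDr.
Qed.

End bounded_duality.

(** * Uniform integrability of sublevel products *)

Section uniform_integrability.
Context d {T : measurableType d} {R : realType} (P : probability T R).
Local Notation M := {mfun T >-> R}.
Local Notation intg f := (P.-integrable setT (EFin \o f)).
Local Notation Ex f := (Rintegral P setT f).
Local Notation dom := (@dom_conj_Loo d T R P).
Implicit Types (X Y Z V W : M) (A : set T).

Definition absrv X : M := max_mfun X (- X).

Lemma absrvE X w : absrv X w = `|X w|.
Proof.
by rewrite /absrv !mfE; case: (ger0P (X w)) => X0; case: (ltP (X w) (- X w)) => //; lra.
Qed.

Definition on_set A (mA : measurable A) X : M := X * indic_mfun A mA.

Lemma on_setE A (mA : measurable A) X w : on_set mA X w = X w * \1_A w.
Proof. by []. Qed.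

Lemma on_set_in A (mA : measurable A) X w : A w -> on_set mA X w = X w.
Proof. by move=> Aw; rewrite on_setE indicE mem_set// mulr1. Qed.

Lemma on_set_notin A (mA : measurable A) X w : ~ A w -> on_set mA X w = 0.
Proof. by move=> Aw; rewrite on_setE indicE memNset// mulr0. Qed.

Lemma on_set_bound A (mA : measurable A) X w : 0 <= X w ->
  0 <= on_set mA X w <= X w.
Proof.
move=> X0; have [Aw|Aw] := pselect (A w).
  by rewrite on_set_in// X0 lexx.
by rewrite on_set_notin// lexx X0.
Qed.

Variables (E : set M) (psi : M -> R).
Hypothesis E_solid : solid_space P E.
Hypothesis E_cst : contains_constants P E.
Hypothesis psi_mc : monotone_convex P E psi.
Let sE := solid_subspace E_solid.

Lemma absrv_in X : E X -> E (absrv X).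
Proof. by move=> EX; apply: (solid_le E_solid EX) => w; rewrite absrvE normr_id. Qed.

Lemma solid_between X Y : E Y -> (forall w, 0 <= X w <= Y w) -> E X.
Proof.
move=> EY XY; apply: (solid_le E_solid EY) => w.
by have /andP[X0 XYw] := XY w; rewrite !ger0_norm// (le_trans X0).
Qed.

Let intgM X Z : E X -> dom psi Z -> intg (X \* Z).
Proof. exact: dom_intgM. Qed.

Lemma le_ExM X Y Z : E X -> E Y -> dom psi Z -> (\forall w \ae P, X w <= Y w) ->
  Ex (X \* Z) <= Ex (Y \* Z).
Proof.
move=> EX EY dZ XY; have Z0 := dom_ge0 E_solid E_cst psi_mc dZ.
apply: ae_le_Ex; [exact: intgM|exact: intgM|].
by move: XY Z0; apply: filterS2 => w XY Zw; exact: ler_wpM2r.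
Qed.

Lemma ExM_cvg0 (W_ : nat -> M) Y Z : E Y -> dom psi Z ->
  (forall n, \forall w \ae P, `|W_ n w| <= Y w) ->
  (\forall w \ae P, W_ n w @[n --> \oo] --> 0) ->
  Ex (W_ n \* Z) @[n --> \oo] --> 0.
Proof.
move=> EY dZ WY W0; rewrite -[X in _ --> X](Ex_cst P).
have iYZ : intg (Y \* Z) by exact: intgM.
apply: (ae_dominated_Ex_cvg (g := fun w => `|(Y \* Z) w|)) => //.
- move: W0; apply: filterS => w W0.
  suff : (fun n => W_ n w * Z w) @ \oo --> 0 by [].
  by rewrite -(mul0r (Z w)); exact: (cvgMr_tmp (b := Z w) W0).
- move=> n; move: (WY n); apply: filterS => w WYw.
  rewrite -[(W_ n \* Z) w]/(W_ n w * Z w) -[(Y \* Z) w]/(Y w * Z w) !normrM.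
  by rewrite ler_wpM2r// (le_trans WYw)// ler_norm.
- exact: intg_norm.
Qed.

(* [F] stands for [psi] or for the dual supremum. *)
Variables (F : M -> R) (C : R).
Hypothesis F_bound : forall V Z, E V -> (forall w, 0 <= V w) -> dom psi Z ->
  Ex (V \* Z) <= F V + alpha P psi Z.
Hypothesis F_cont : forall W_ : nat -> M, E (W_ 0%N) ->
  (forall n w, 0 <= W_ n.+1 w <= W_ n w) -> (forall w, 0 <= W_ 0%N w) ->
  (\forall w \ae P, W_ n w @[n --> \oo] --> 0) ->
  exists N, F (W_ N) <= C + 1.

(* Bad sets [A n] with [P (A n) <= 2^-n] are replaced by the decreasing unions of
   their tails, on which [F] is controlled. *)
Let absolute_continuity X (c e : R) : E X -> (forall w, 0 <= X w) -> 0 < e ->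
  exists2 del : R, 0 < del & forall A (mA : measurable A) Z,
    (P A <= del%:E)%E -> dom psi Z -> alpha P psi Z <= c ->
    Ex (on_set mA X \* Z) <= e.
Proof.
move=> EX X0 e0; apply: contrapT => nd.
have {}nd (n : nat) : exists AZ : set T * M, measurable AZ.1 /\
    [/\ (P AZ.1 <= (2^-1 ^+ n)%:E)%E, dom psi AZ.2, alpha P psi AZ.2 <= c &
        forall mA : measurable AZ.1, e < Ex (on_set mA X \* AZ.2)].
  apply: contrapT => nAZ; apply: nd; exists (2^-1 ^+ n).
    by rewrite exprn_gt0// invr_gt0.
  move=> A mA Z PA dZ Zc; rewrite leNgt; apply/negP => eA.
  apply: nAZ; exists (A, Z); split; first exact: mA.
  split; [exact: PA|exact: dZ|exact: Zc|].
  by move=> mA'; rewrite (Prop_irrelevance mA' mA).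
have [AZ HAZ] := choice nd.
pose A n := (AZ n).1; pose Z n := (AZ n).2.
have mA n : measurable (A n) by case: (HAZ n).
have PA n : (P (A n) <= (2^-1 ^+ n)%:E)%E by case: (HAZ n) => _ [].
pose B n := \bigcup_(k in [set k | (n <= k)%N]) A k.
have mB n : measurable (B n) by apply: bigcup_measurable.
pose lam := (`|C| + `|c| + 1) / e.
have lam0 : 0 < lam by rewrite divr_gt0// ltr_wpDl// addr_ge0.
have lam0' := ltW lam0.
pose W n : M := lam *: on_set (mB n) X.
have WE n w : W n w = lam * on_set (mB n) X w by [].
have W0 n w : 0 <= W n w.
  by rewrite WE mulr_ge0//; case/andP: (on_set_bound (mB n) (X0 w)).
have EW n : E (W n).
  apply: (solid_between (vector_subspaceZ lam sE EX)) => w.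
  rewrite W0 WE mfE ler_wpM2l//.
  by case/andP: (on_set_bound (mB n) (X0 w)).
have [|||N FN] := F_cont (EW 0%N).
- move=> n w; rewrite W0 andTb !WE; apply: ler_wpM2l => //.
  have [Bw|Bw] := pselect (B n.+1 w).
    rewrite !on_set_in//; case: Bw => k /= nk Ak; exists k => //=.
    exact: ltnW.
  by rewrite on_set_notin//; have /andP[] := on_set_bound (mB n) (X0 w).
- by move=> w; exact: W0.
- have := small_sets_ae_eventually mA PA; apply: filterS => w [N HN].
  apply: cvg_near_cst; exists N => // n Nn.
  suff : W n w = 0 by [].
  rewrite WE on_set_notin ?mulr0//.
  by case=> k nk; apply: HN; exact: leq_trans Nn nk.
have [_ [_ dZ Zc eA]] := HAZ N.
have ineq : lam * Ex (on_set (mA N) X \* Z N) <= C + 1 + c.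
  have EA : E (on_set (mA N) X).
    by apply: (solid_between EX) => w; exact: on_set_bound.
  have iA : intg (on_set (mA N) X \* Z N) by exact: intgM.
  rewrite -ExZ//; apply: (@le_trans _ _ (Ex (W N \* Z N))).
    have -> : (fun w => lam * (on_set (mA N) X \* Z N) w) =
        (lam *: on_set (mA N) X : M) \* Z N.
      by apply/funext => w; exact: mulrA.
    apply: le_ExM => //; first exact: vector_subspaceZ.
    apply: aeW => w; rewrite WE mfE ler_wpM2l//.
    have [Aw|Aw] := pselect (A N w).
      by rewrite !on_set_in//; exists N => /=.
    by rewrite on_set_notin//; have /andP[] := on_set_bound (mB N) (X0 w).
  apply: (le_trans (F_bound (EW N) (W0 N) dZ)).
  exact: lerD.
have : lam * e < C + 1 + c.
  by apply: lt_le_trans ineq; rewrite ltr_pM2l//; exact: eA.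
rewrite /lam divfK ?gt_eqF// addrAC ltNge => /negP; apply.
by rewrite lerD ?ler_norm// lerD2r ler_norm.
Qed.

Let markov_bound V (K c : R) : 0 < K -> intg V -> (forall w, 0 <= V w) ->
  Ex V <= c -> (P [set w | (K < V w)%R] <= (c / K)%:E)%E.
Proof.
move=> K0 iV V0 Vc.
pose A := [set w | K < V w].
have mA : measurable A.
  by rewrite -[A]setTI; apply: measurable_fun_ltr => //; exact: measurable_cst.
have EI : Ex (\1_A) = fine (P A) by rewrite /Rintegral integral_indic// setIT.
have iI : intg (\1_A) by exact: integrable_indic.
have PA : P A = (fine (P A))%:E by rewrite fineK//; exact: fin_num_measure.
rewrite PA lee_fin ler_pdivlMr// mulrC -EI -ExZ//.
apply: le_trans Vc; apply: ae_le_Ex => //; first exact: intgZ.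
apply: aeW => w; have [Aw|Aw] := pselect (A w).
  by rewrite /= indicE mem_set// mulr1 ltW.
by rewrite /= indicE memNset// mulr0.
Qed.

(** On a sublevel set of the conjugate, [E[X Z 1_A]] is at most
    [(F (t X 1_A) + c) / t], so that it is small as soon as [t] is large and
    [F (t X 1_A)] is bounded. *)
Lemma sublevel_uniformly_integrable X (c : R) : E X ->
  uniformly_integrable P [set X \* Z | Z in [set Z : {RV P >-> R} |
    L1 P Z /\ (conj_Loo P psi Z <= c%:E)%E]].
Proof.
move=> EX e e0.
have EXa := absrv_in EX.
have Xa0 w : 0 <= absrv X w by rewrite absrvE.
have [del del0 Hdel] := absolute_continuity c EXa Xa0 e0.
pose b := `|F (absrv X)| + `|c|.
exists (Num.max 0 (b / del)); split; first exact: num_real.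
move=> K; rewrite gt_max => /andP[K0 /ltW bK] _ [Z [/L1P iZ Zc] <-].
have [dZ Zc'] := conj_le_dom iZ Zc.
have Z0 := dom_ge0 E_solid E_cst psi_mc dZ.
have iXZ : intg (X \* Z) by exact: intgM.
pose V : M := absrv (X * Z).
have VE w : V w = `|X w * Z w| by rewrite /V absrvE.
have iV : intg V.
  by apply: ae_eq_intg (intg_norm iXZ) => //; apply: aeW => w; rewrite VE.
have VXZ : \forall w \ae P, V w = (absrv X \* Z) w.
  move: Z0; apply: filterS => w Zw.
  by rewrite VE -[RHS]/(absrv X w * Z w) absrvE normrM (ger0_norm Zw).
have EV : Ex V <= b.
  rewrite (ae_eq_Ex _ _ VXZ)//; apply: (le_trans (F_bound EXa Xa0 dZ)).
  by apply: lerD; [exact: ler_norm|rewrite (le_trans Zc')// ler_norm].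
pose A := [set w | K < V w].
have mA : measurable A.
  by rewrite -[A]setTI; apply: measurable_fun_ltr => //; exact: measurable_cst.
have PA : (P A <= del%:E)%E.
  apply: (le_trans (markov_bound K0 iV _ EV)); first by move=> w; rewrite VE.
  by rewrite lee_fin ler_pdivrMr//; move: bK; rewrite ler_pdivrMr// mulrC.
have -> : [set w | K < `|(X \* Z) w|] = A.
  by apply/seteqP; split => w; rewrite /A /mkset VE.
have iA : intg (on_set mA (absrv X) \* Z).
  apply: intgM => //; apply: (solid_between EXa) => w; exact: on_set_bound.
have -> : (fun w => `|(X \* Z) w|%:E) = EFin \o V.
  by apply/funext => w; exact: (congr1 EFin (esym (VE w))).
rewrite integral_mkcond.
have -> : (\int[P]_w ((EFin \o V) \_ A) w =
    (Ex (on_set mA (absrv X) \* Z))%:E)%E.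
  rewrite -EFin_Ex//; apply: ae_eq_integral => //.
  - apply: (measurable_restrictT _ mA).1; apply: measurable_funTS.
    exact/measurable_EFinP.
  - exact/measurable_EFinP.
  - move: VXZ; apply: filterS => w VXZ _; rewrite patchE.
    rewrite -[(on_set _ _ \* Z) w]/(on_set mA (absrv X) w * Z w).
    case: ifPn => wA.
      rewrite on_set_in; last by rewrite inE in wA.
      exact: (congr1 EFin VXZ).
    by rewrite on_set_notin ?mul0r//; rewrite notin_setE in wA.
by rewrite lee_fin; exact: Hdel.
Qed.

End uniform_integrability.

(** * The Lebesgue property *)

Section lebesgue_property.
Context d {T : measurableType d} {R : realType} (P : probability T R).
Local Notation M := {mfun T >-> R}.
Local Notation intg f := (P.-integrable setT (EFin \o f)).
Local Notation Ex f := (Rintegral P setT f).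
Local Notation dom := (@dom_conj_Loo d T R P).
Implicit Types (X Y Z V W : M) (A : set T).
Variables (E : set M) (psi : M -> R).
Hypothesis E_solid : solid_space P E.
Hypothesis E_cst : contains_constants P E.
Hypothesis psi_mc : monotone_convex P E psi.
Hypothesis psi_fatou : fatou_property P E psi.
Let sE := solid_subspace E_solid.

Let intgM X Z : E X -> dom psi Z -> intg (X \* Z).
Proof. exact: dom_intgM. Qed.

Definition sublevel_products X (c : R) := [set X \* Z | Z in [set Z : {RV P >-> R} |
  L1 P Z /\ (conj_Loo P psi Z <= c%:E)%E]].

Lemma lebesgue_uniformly_integrable : lebesgue_property P E psi ->
  forall X (c : R), E X -> uniformly_integrable P (sublevel_products X c).
Proof.
move=> leb X c EX.
apply: (sublevel_uniformly_integrable E_solid E_cst psi_mc (F := psi)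
  (C := psi (cst 0)) _ _ c EX) => [V Z EV V0 dZ|W_ EW Wd W0 Wc].
  have [|_ ->//] := fenchel E_solid E_cst psi_mc EV _ dZ; exact: aeW.
have Wd0 n w : W_ n w <= W_ 0%N w.
  by elim: n => // n; apply: le_trans; case/andP: (Wd n w).
have Wge0 n w : 0 <= W_ n w by case: n => // n; case/andP: (Wd n w).
have : dominated_ae_cvg (P := P) E W_ (cst 0).
  split => //.
    by move=> n; apply: (solid_between E_solid EW) => w; rewrite Wge0 Wd0.
  exists (W_ 0%N); split => //; first exact: aeW.
  by move=> n; apply: aeW => w; rewrite ger0_norm.
move=> /leb/(cvg_seqP _ _).1/(_ _ ltr01)[N /(_ _ (leqnn N))].
by move=> /ler_distlDr ?; exists N.
Qed.

Let sum3 (x a b c e : R) : x <= a + b + c -> a <= e / 3 -> b <= e / 3 ->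
  c <= e / 3 -> x <= e.
Proof. lra. Qed.

Let small_penalty (p e x al : R) : 0 < e -> x <= e / 2 -> - p <= al ->
  p + e <= x - al -> False.
Proof. lra. Qed.

Let large_penalty (p q e c x al : R) : 0 < e -> q - 2 * p <= c -> c <= al ->
  2 * x <= q + al -> p + e <= x - al -> False.
Proof. lra. Qed.

Section uniformly_integrable_sublevels.
Hypothesis psi_ui : forall X (c : R), E X -> 0 < c ->
  uniformly_integrable P (sublevel_products X c).
Variables (W_ : nat -> M) (Y : M).
Hypothesis EY : E Y.
Hypothesis Y0 : forall w, 0 <= Y w.
Hypothesis WY : forall n, \forall w \ae P, 0 <= W_ n w <= Y w.
Hypothesis W0 : \forall w \ae P, W_ n w @[n --> \oo] --> 0.

Let EW n : E (W_ n).
Proof.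
apply: (solid_ae E_solid EY); move: (WY n); apply: filterS => w /andP[Wn0 WnY].
by rewrite ger0_norm.
Qed.

(* [W_n Z] is at most [eta Z + |Y Z| 1_(|Y Z| > K) + K 1_(W_n > eta)]: the terms
   have small expectation by the bound on [E[Z]], by uniform integrability and by
   convergence in probability, in this order. *)
Let uniformly_small (c e : R) : 0 < c -> 0 < e -> exists N, forall n, (N <= n)%N ->
  forall Z, dom psi Z -> alpha P psi Z <= c -> Ex (W_ n \* Z) <= e.
Proof.
move=> c0 e0; have e30 : 0 < e / 3 by rewrite divr_gt0.
have [K0 [_ HK0]] := psi_ui EY c0 e30.
pose K := Num.max K0 0 + 1.
have K0K : K0 < K by rewrite /K ltr_pwDr// le_max lexx.
have Kgt0 : 0 < K by rewrite /K ltr_pwDr// le_max lexx orbT.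
have {HK0} HK := HK0 _ K0K.
pose b := `|psi (cst 1)| + `|c|.
have b0 : 0 <= b by rewrite addr_ge0.
pose eta := e / 3 / (b + 1).
have b10 : 0 < b + 1 by rewrite ltr_wpDl.
have eta0 : 0 < eta by rewrite divr_gt0.
pose D n := [set w | eta < W_ n w].
have mD n : measurable (D n).
  by rewrite -[D n]setTI; apply: measurable_fun_ltr => //; exact: measurable_cst.
have D0 : Ex (\1_(D n)) @[n --> \oo] --> 0.
  rewrite -[X in _ --> X](Ex_cst P).
  apply: (ae_dominated_Ex_cvg (g := fun=> 1)) => //.
  - move: W0; apply: filterS => w W0w; apply: cvg_near_cst.
    have [N HN] := (cvg_seqP _ _).1 W0w eta eta0; exists N => // n Nn.
    rewrite /= indicE memNset// /D /= => /(lt_le_trans)/(_ (ler_norm _)).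
    by have := HN n Nn; rewrite subr0 leNgt => /negP.
  - move=> n; apply: aeW => w; rewrite /= indicE.
    by case: (_ \in _); rewrite ?normr1 ?normr0.
  - exact: intg_cst.
have [N HN] := (cvg_seqP _ _).1 D0 (e / 3 / K) (divr_gt0 e30 Kgt0).
exists N => n Nn Z dZ Zc.
have iZ := dom_intg dZ; have Z0 := dom_ge0 E_solid E_cst psi_mc dZ.
have iYZ := intgM EY dZ.
pose V : M := absrv (Y * Z).
have VE w : V w = `|Y w * Z w| by rewrite /V absrvE.
have iV : intg V.
  by apply: ae_eq_intg (intg_norm iYZ) => //; apply: aeW => w; rewrite VE.
pose A := [set w | K < V w].
have mA : measurable A.
  by rewrite -[A]setTI; apply: measurable_fun_ltr => //; exact: measurable_cst.
have iA : intg (on_set mA V).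
  apply: (ae_le_intg (g := fun w => `|V w|)) => //; last exact: intg_norm.
  apply: aeW => w; have V0 : 0 <= V w by rewrite VE.
  by have /andP[? ?] := on_set_bound mA V0; rewrite !ger0_norm.
have iD : intg (\1_(D n)) by exact: integrable_indic.
have EA : Ex (on_set mA V) <= e / 3.
  rewrite -lee_fin -EFin_Ex//.
  have := HK (Y \* Z); have -> : [set w | K < `|(Y \* Z) w|] = A.
    by apply/seteqP; split => w; rewrite /A /mkset VE.
  have -> : (fun w => `|(Y \* Z) w|%:E) = EFin \o V.
    by apply/funext => w; exact: (congr1 EFin (esym (VE w))).
  rewrite integral_mkcond => HKA; apply: le_trans (HKA _); last first.
    by exists Z => //; split; [exact/L1P|rewrite alphaE// lee_fin].
  rewrite le_eqVlt; apply/orP; left; apply/eqP; apply: eq_integral => w _.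
  rewrite patchE; case: ifPn => wA.
    by rewrite on_set_in//; rewrite inE in wA.
  by rewrite on_set_notin//; rewrite notin_setE in wA.
have EZ : eta * Ex Z <= e / 3.
  have [|_] := fenchel E_solid E_cst psi_mc (E_cst 1) _ dZ; first exact: aeW.
  have -> : (cst 1 : M) \* Z = Z :> (T -> R) by apply/funext => w; exact: mul1r.
  move=> EZ; have {}EZ : Ex Z <= b.
    by rewrite (le_trans EZ)// lerD ?ler_norm// (le_trans Zc)// ler_norm.
  apply: (@le_trans _ _ (eta * (b + 1))); last by rewrite /eta divfK ?gt_eqF.
  by rewrite ler_wpM2l ?(ltW eta0)// (le_trans EZ)// lerDl.
have ED : K * Ex (\1_(D n)) <= e / 3.
  rewrite mulrC -ler_pdivlMr//; have := HN n Nn; rewrite subr0.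
  by apply: le_trans; exact: ler_norm.
have iS : intg (fun w => eta * Z w + on_set mA V w + K * \1_(D n) w).
  by apply: intgD; [apply: intgD => //; exact: intgZ|exact: intgZ].
apply: (sum3 _ EZ EA ED).
have -> : eta * Ex Z + Ex (on_set mA V) + K * Ex (\1_(D n)) =
    Ex (fun w => eta * Z w + on_set mA V w + K * \1_(D n) w).
  rewrite ExD; [|by apply: intgD => //; exact: intgZ|exact: intgZ].
  by rewrite ExD ?ExZ//; exact: intgZ.
apply: ae_le_Ex => //; first exact: intgM.
move: Z0 (WY n); apply: filterS2 => w Zw /andP[Wn0 WnY].
suff : W_ n w * Z w <= eta * Z w + on_set mA V w + K * \1_(D n) w by [].
have V0 : 0 <= V w by rewrite VE.
have [A0 _] := andP (on_set_bound mA V0).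
have D0' : 0 <= K * \1_(D n) w :> R by rewrite mulr_ge0// ?(ltW Kgt0)// indicE.
have eZ : 0 <= eta * Z w by rewrite mulr_ge0// ltW.
have [Dw|Dw] := pselect (D n w); last first.
  rewrite -addrA; apply: ler_wpDr; first exact: addr_ge0.
  by rewrite ler_wpM2r// leNgt; apply/negP.
have WV : W_ n w * Z w <= V w.
  by rewrite VE ger0_norm ?ler_wpM2r// mulr_ge0.
have [Aw|Aw] := pselect (A w).
  rewrite on_set_in// (le_trans WV)// addrAC ler_wpDl// addr_ge0//.
rewrite on_set_notin// addr0 indicE mem_set// mulr1 ler_wpDl//.
by rewrite (le_trans WV)// leNgt; apply/negP.
Qed.

(** By duality [psi (min W_n k)] is nearly attained at some [Z]; a [Z] with a large
    conjugate is excluded by [E[Y Z] <= (psi (2 Y) + alpha Z) / 2], and over the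
    others [E[W_n Z]] is uniformly small. *)
Lemma dominated_null_psi (e : R) : 0 < e -> exists N, forall n, (N <= n)%N ->
  psi (W_ n) <= psi (cst 0) + e.
Proof.
move=> e0.
have E2Y : E (2 *: Y) by exact: vector_subspaceZ.
(* Above this level of the conjugate no [Z] comes close to attaining the value. *)
pose c := `|psi (2 *: Y)| + 2 * `|psi (cst 0)| + 1.
have c0 : 0 < c by rewrite /c ltr_wpDl// addr_ge0// mulr_ge0.
have qc : psi (2 *: Y) - 2 * psi (cst 0) <= c.
  rewrite /c -addrA; apply: lerD; first exact: ler_norm.
  by rewrite ler_wpDr// -mulrN ler_wpM2l// -normrN ler_norm.
have e20 : 0 < e / 2 by rewrite divr_gt0.
have [N HN] := uniformly_small c0 e20.
exists N => n Nn.
pose Wk k : M := min_mfun (W_ n) (cst k%:R).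
have Wk0 k : \forall w \ae P, 0 <= Wk k w.
  by move: (WY n); apply: filterS => w /andP[Wn0 _]; rewrite /Wk mfE le_min Wn0/=.
have WkW k w : Wk k w <= W_ n w by rewrite /Wk mfE ge_min lexx.
have bWk k : ae_bounded P (Wk k).
  exists k%:R; move: (Wk0 k); apply: filterS => w Wkw.
  by rewrite ger0_norm// /Wk mfE ge_min lexx orbT.
have EWk k : E (Wk k) by exact: (bounded_in_E E_solid E_cst).
have WkY k : \forall w \ae P, `|Wk k w| <= Y w.
  move: (Wk0 k) (WY n); apply: filterS2 => w Wkw /andP[_ WnY].
  by rewrite ger0_norm// (le_trans (WkW k w)).
apply: (fatou_le psi_fatou (X_ := Wk) (u := fun=> psi (cst 0) + e)).
- split => //; first by exists Y; split => //; exact: aeW.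
  apply: aeW => w; apply: cvg_near_cst; near=> k.
  suff : Wk k w = W_ n w by [].
  rewrite /Wk mfE min_l// ltW// (le_lt_trans (ler_norm _))//.
  by near: k; exact: nbhs_infty_gtr.
- move=> k; rewrite leNgt; apply/negP => psik.
  have [Z dZ aZ] := bounded_duality E_solid E_cst psi_mc psi_fatou (bWk k) psik.
  have [alc|cal] := leP (alpha P psi Z) c.
    apply: (small_penalty e0 _ (alpha_ge dZ) aZ).
    apply: le_trans (HN n Nn _ dZ alc).
    by apply: (le_ExM E_solid E_cst psi_mc) => //; exact: aeW.
  apply: (large_penalty e0 qc (ltW cal) _ aZ).
  have [|_] := fenchel E_solid E_cst psi_mc E2Y _ dZ.
    by apply: aeW => w; rewrite mfE mulr_ge0.
  apply: le_trans.
  have -> : (2 *: Y : M) \* Z = (fun w => 2 * (Y \* Z) w).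
    by apply/funext => w; exact: esym (mulrA _ _ _).
  rewrite ExZ; last exact: intgM.
  rewrite ler_wpM2l//; apply: (le_ExM E_solid E_cst psi_mc) => //.
  by move: (WkY k); apply: filterS => w; apply: le_trans; exact: ler_norm.
- exact: cvg_cst_seq.
Unshelve. all: by end_near. Qed.

End uniformly_integrable_sublevels.

Let half01 : (0 : R) <= (2^-1 : R) <= (1 : R). Proof. lra. Qed.

Let interpolation (l x y p e D : R) : 0 < e -> 1 <= l -> `|D - p| / e <= l ->
  x <= l^-1 * y + (1 - l^-1) * p -> y <= D -> x - p <= e.
Proof.
move=> e0 l1 Dl xy yD; have l0 : 0 < l by lra.
have : l^-1 * (D - p) <= e.
  rewrite ler_pdivrMl// mulrC -ler_pdivrMl// mulrC.
  by apply: le_trans Dl; rewrite ler_pM2r ?invr_gt0// ler_norm.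
have := ler_wpM2l (ltW (etrans (invr_gt0 l) l0)) yD.
rewrite mulrBr; lra.
Qed.

(** Writing [X_n] as [(1 - 1/l) X + (1/l) (X + l (X_n - X))], convexity reduces the
    upper bound on [psi (X_n)] to a bound on [psi (2 l |X_n - X|)] that holds for
    large [n] and does not depend on [l]. *)
Lemma uniformly_integrable_lebesgue :
  (forall X (c : R), E X -> 0 < c ->
    uniformly_integrable P (sublevel_products X c)) ->
  lebesgue_property P E psi.
Proof.
move=> ui X_ X /[dup] dX [EX_ [Y0 [EY0 Y0ge X_Y0]] X_X].
pose Y := absrv Y0.
have EY : E Y by exact: (absrv_in E_solid).
have Yge w : 0 <= Y w by rewrite /Y absrvE.
have X_Y n : \forall w \ae P, `|X_ n w| <= Y w.
  by move: (X_Y0 n); apply: filterS => w XYw; rewrite /Y absrvE (le_trans XYw)// ler_norm.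
have XY : \forall w \ae P, `|X w| <= Y w.
  move: (ae_foralln X_Y) X_X; apply: filterS2 => w XYw XXw.
  have cX := cvg_norm_seq XXw; rewrite -(cvg_lim _ cX)//.
  apply: limr_le; first by apply/cvg_ex; exists `|X w|.
  exact: nearW.
have EX : E X by exact: (solid_ae E_solid EY XY).
apply/cvg_seqP => e e0.
have lower : exists N, forall n, (N <= n)%N -> psi X - e <= psi (X_ n).
  have : ((psi X - e)%:E < limn_einf (fun n => (psi (X_ n))%:E))%E.
    by apply: lt_le_trans (psi_fatou dX); rewrite lte_fin ltrBlDr ltrDl.
  move=> /lt_limn_einf[N _ HN]; exists N => n Nn.
  by apply: ltW; rewrite -lte_fin; exact: HN.
pose D := 2^-1 * psi (2 *: absrv X) + (1 - 2^-1) * (psi (cst 0) + 1).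
pose l := `|D - psi X| / e + 1.
have l1 : 1 <= l by rewrite /l lerDr divr_ge0// ltW.
have l0 : 0 < l by exact: lt_le_trans ltr01 l1.
have l01 : 0 <= l^-1 <= 1 by rewrite invr_ge0 (ltW l0) invf_le1.
pose W_ n : M := (2 * l) *: absrv (X_ n - X).
have WE n w : W_ n w = 2 * l * `|X_ n w - X w| by rewrite /W_ mfE absrvE.
have l20 : 0 <= 2 * l by rewrite mulr_ge0// ltW.
pose YY : M := (2 * l) *: (2 *: Y).
have EYY : E YY := vector_subspaceZ _ sE (vector_subspaceZ _ sE EY).
have YYE w : YY w = 2 * l * (2 * Y w) by [].
have YYge w : 0 <= YY w by rewrite YYE mulr_ge0// mulr_ge0.
have WY n : \forall w \ae P, 0 <= W_ n w <= YY w.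
  move: (X_Y n) XY; apply: filterS2 => w XYn XYw.
  rewrite WE mulr_ge0// andTb YYE ler_wpM2l// mulr_natl mulr2n.
  by rewrite (le_trans (ler_normB _ _))// lerD.
have W0 : \forall w \ae P, W_ n w @[n --> \oo] --> 0.
  move: X_X; apply: filterS => w XXw; under eq_fun do rewrite WE.
  have := cvgZ_seq (c := 2 * l) (cvg_norm_seq (cvgB_seq XXw (cvg_cst_seq (X w)))).
  by rewrite subrr normr0 mulr0.
have [N1 HN1] := dominated_null_psi ui EYY YYge WY W0 ltr01.
have [N2 HN2] := lower.
exists (maxn N1 N2) => n; rewrite geq_max => /andP[/HN1 psiW /HN2 psil].
rewrite ler_distl psil /= addrC -lerBlDr.
have EV : E (X + l *: (X_ n - X)).
  by apply: vector_subspaceD => //; apply: vector_subspaceZ => //; exact: vector_subspaceB.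
have E2X : E (2 *: absrv X) by apply: vector_subspaceZ => //; exact: (absrv_in E_solid).
have EWn : E (W_ n).
  by apply: vector_subspaceZ => //; apply: (absrv_in E_solid); exact: vector_subspaceB.
apply: (interpolation e0 l1 (y := psi (X + l *: (X_ n - X))) (D := D)).
- by rewrite /l lerDl.
- have := psi_convex psi_mc EV EX l01.
  suff : l^-1 *: (X + l *: (X_ n - X)) + (1 - l^-1) *: (X + 0) = X_ n.
    by rewrite addr0 => ->.
  rewrite conv_translate scaler0 addr0 scalerA mulVf ?gt_eqF//.
  by rewrite scale1r addrC subrK.
- apply: (@le_trans _ _ (psi (2^-1 *: (2 *: absrv X) + (1 - 2^-1) *: W_ n))).
    apply: (psi_le psi_mc) => //; first by exact: sE.2.
    apply: aeW => w.
    rewrite -[leRHS]/(2^-1 * (2 * absrv X w) + (1 - 2^-1) * W_ n w) WE absrvE.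
    rewrite -[leLHS]/(X w + l * (X_ n w - X w)).
    have -> : (1 - 2^-1) * (2 * l * `|X_ n w - X w|) = l * `|X_ n w - X w| by field.
    by rewrite mulKf// lerD ?ler_norm// ler_wpM2l ?ler_norm// ltW.
  apply: (le_trans (psi_convex psi_mc E2X EWn half01)).
  by rewrite lerD2l ler_wpM2l//; case/andP: half01; rewrite subr_ge0.
Qed.

Let norm_clip (x k : R) : 0 <= k ->
  `|Num.max (Num.min x k) (- k)| <= `|x| /\ `|Num.max (Num.min x k) (- k)| <= k.
Proof.
move=> k0; have x1 := ler_norm x; have x2 := ler_norm (- x); rewrite normrN in x2.
rewrite !ler_norml; have [h1|h1] := leP x k; have [h2|h2] := leP _ (- k);
  split; lra.
Qed.

(** The Lebesgue property lets the inequality pass from the truncations of [X] to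
    [X], of any sign. *)
Lemma truncation_fenchel X Z : lebesgue_property P E psi -> E X -> dom psi Z ->
  Ex (X \* Z) <= psi X + alpha P psi Z.
Proof.
move=> leb EX dZ.
pose T_ k : M := max_mfun (min_mfun X (cst k%:R)) (cst (- k%:R)).
have TE k w : T_ k w = Num.max (Num.min (X w) k%:R) (- k%:R) by [].
have TX k w : `|T_ k w| <= `|X w| by rewrite TE; case: (norm_clip (X w) (ler0n R k)).
have Tk k w : `|T_ k w| <= k%:R by rewrite TE; case: (norm_clip (X w) (ler0n R k)).
have Tc w : T_ k w @[k --> \oo] --> X w.
  apply: cvg_near_cst; near=> k.
  have Xk : `|X w| < k%:R by near: k; exact: nbhs_infty_gtr.
  suff : T_ k w = X w by [].
  move: Xk; rewrite TE ltr_norml => /andP[h1 h2].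
  by rewrite (min_l (ltW h2)) (max_l (ltW h1)).
have dT : dominated_ae_cvg (P := P) E T_ X.
  split.
  - by move=> k; apply: (solid_le E_solid EX).
  - exists (absrv X); split; first exact: (absrv_in E_solid).
      by apply: aeW => w; rewrite absrvE.
    by move=> k; apply: aeW => w; rewrite absrvE.
  - exact: aeW.
have iXZ := intgM EX dZ.
have c1 : Ex (T_ k \* Z) @[k --> \oo] --> Ex (X \* Z).
  apply: (ae_dominated_Ex_cvg (g := fun w => `|(X \* Z) w|)) => //.
  - by apply: aeW => w; exact: (cvgMr_tmp (b := Z w) (Tc w)).
  - move=> k; apply: aeW => w.
    rewrite -[(T_ k \* Z) w]/(T_ k w * Z w) -[(X \* Z) w]/(X w * Z w) !normrM.
    by rewrite ler_wpM2r.
  - exact: intg_norm.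
have c2 := cvgD_seq (leb _ _ dT) (cvg_cst_seq (alpha P psi Z)).
rewrite -(cvg_lim _ c1)// -(cvg_lim _ c2)//; apply: ler_lim.
- by apply/cvg_ex; exists (Ex (X \* Z)).
- by apply/cvg_ex; exists (psi X + alpha P psi Z).
- apply: nearW => k; apply: alpha_fenchel => //.
  by exists k%:R; exact: aeW.
Unshelve. all: by end_near. Qed.

(** A subgradient [phi] of [psi] at [X] is order continuous because
    [phi U <= psi (X + U) - psi X], and its density attains the supremum. *)
Lemma lebesgue_dual_attained : lebesgue_property P E psi -> forall X, E X ->
  (psi X)%:E = dual_sup P psi X /\ dual_attained P psi X.
Proof.
move=> leb X EX.
have [phi phi_lin phi_psi] := convex_subgradient sE (psi_convex psi_mc) EX.
have phi_ge0 V : E V -> (\forall w \ae P, 0 <= V w) -> 0 <= phi V.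
  move=> EV V0; have := phi_psi _ (vector_subspaceN sE EV).
  have -> : phi (- V) = - phi V.
    have := phi_lin (-1) 0 _ _ EV EV.
    by rewrite scaleN1r scale0r addr0 mulN1r mul0r addr0.
  have : psi (X - V) <= psi X.
    apply: (psi_le psi_mc) => //; first exact: vector_subspaceB.
    by move: V0; apply: filterS => w Vw; rewrite !mfE gerBl.
  move: (psi _) (psi _) (phi _) => p q r; lra.
have phi_cont (U_ : nat -> M) (Y : M) : E Y ->
    (forall n w, 0 <= U_ n w <= Y w) -> (forall w, U_ n w @[n --> \oo] --> 0) ->
    phi (U_ n) @[n --> \oo] --> 0.
  move=> EY UY U0.
  have EU n : E (U_ n) by exact: (solid_between E_solid EY).
  have AE w : (absrv X + Y : M) w = `|X w| + Y w by rewrite -absrvE.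
  have dU : dominated_ae_cvg (P := P) E (fun n => X + U_ n) X.
    split.
    - by move=> n; exact: vector_subspaceD.
    - exists (absrv X + Y); split.
      + by apply: vector_subspaceD => //; exact: (absrv_in E_solid).
      + apply: aeW => w; rewrite AE addr_ge0//.
        by have /andP[/le_trans] := UY 0%N w; apply.
      + move=> n; apply: aeW => w; rewrite AE mfE.
        rewrite (le_trans (ler_normD _ _))// lerD2l.
        by have /andP[? ?] := UY n w; rewrite ger0_norm.
    - apply: aeW => w; have := cvgD_seq (cvg_cst_seq (X w)) (U0 w).
      by rewrite addr0.
  have c1 := cvgB_seq (leb _ _ dU) (cvg_cst_seq (psi X)).
  rewrite subrr in c1.
  apply: (squeeze_cvgr _ (cvg_cst_seq 0) c1); apply: nearW => n.
  rewrite phi_ge0//=; first exact: phi_psi.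
  by apply: aeW => w; case/andP: (UY n w).
have [Z [iZ Z0 phiE]] := order_continuous_representation E_solid E_cst phi_lin
  phi_ge0 phi_cont.
have phiB W : E W -> Ex (W \* Z) - Ex (X \* Z) <= psi W - psi X.
  move=> EW; have EWX := vector_subspaceB sE EW EX.
  rewrite -(phiE W EW).2 -(phiE X EX).2.
  have := phi_lin 1 (-1) _ _ EW EX; rewrite scale1r scaleN1r mul1r mulN1r => <-.
  by have := phi_psi _ EWX; rewrite [X + _]addrC subrK.
have [dZ aZ] : dom psi Z /\ alpha P psi Z <= Ex (X \* Z) - psi X.
  apply: conj_le_dom => //; apply/conj_Loo_leP => // W bW.
  have := phiB W (bounded_in_E E_solid E_cst bW).
  by rewrite addrA lerBlDr addrAC [psi W + _]addrC.
have val : dual_value (P := P) psi X Z = (psi X)%:E.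
  rewrite (dual_valueE E_solid E_cst psi_mc)//; congr EFin; apply/eqP.
  rewrite eq_le lerBlDr truncation_fenchel//=.
  by rewrite lerBrDr addrC -lerBrDr.
have sup : dual_sup P psi X = (psi X)%:E.
  apply/eqP; rewrite eq_le; apply/andP; split.
    apply: ge_ereal_sup => _ [Z' dZ' <-].
    rewrite (dual_valueE E_solid E_cst psi_mc)// lee_fin lerBlDr.
    exact: truncation_fenchel.
  by rewrite -val; apply: ereal_sup_ubound; exists Z.
by split; [rewrite sup|exists Z => //; rewrite sup].
Qed.

End lebesgue_property.

(** * Attained dual suprema *)

Section attained_suprema.
Context d {T : measurableType d} {R : realType} (P : probability T R).
Local Notation M := {mfun T >-> R}.
Local Notation Ex f := (Rintegral P setT f).
Local Notation dom := (@dom_conj_Loo d T R P).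
Implicit Types (X Y Z V W : M).

Let t (n : nat) : R := 2^-1 ^+ n.

Let t_gt0 n : 0 < t n. Proof. by rewrite exprn_gt0// invr_gt0. Qed.

Let tS n : t n.+1 = t n / 2. Proof. by rewrite /t exprS mulrC. Qed.

Let t0 : t 0 = 1. Proof. by []. Qed.

Let t_le1 n : t n <= 1.
Proof. by rewrite exprn_ile1// ?invr_ge0// invf_le1// ler1n. Qed.

Let halfC : 1 - 2^-1 = 2^-1 :> R. Proof. lra. Qed.

Let half01 : (0 : R) <= (2^-1 : R) <= (1 : R). Proof. lra. Qed.

Let t_cvg0 : t @ \oo --> (0 : R).
Proof. by apply: cvg_expr; rewrite ger0_norm ?invr_ge0// invf_lt1// ltr1n. Qed.

Let le0_of_vanishing (x c : R) : (forall m, x <= t m * c) -> x <= 0.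
Proof.
move=> xc; have c1 : (fun m => t m * c) @ \oo --> 0.
  by rewrite -(mul0r c); exact: (cvgMr_tmp (b := c) t_cvg0).
rewrite -(cvg_lim _ c1)//; apply: limr_ge.
  by apply/cvg_ex; exists 0.
exact: nearW.
Qed.

Let step_up (x y a b u v : R) : y <= x + (b - a) * u -> v <= u -> 0 <= a ->
  y + a / 2 * v <= x + (b - a / 2) * u.
Proof. by move=> h uv /ler_wpM2l/(_ _ _ uv); lra. Qed.

Let step_low (x y a b u v : R) : x + (b - a) * u <= y -> v <= u -> 0 <= b - a / 2 ->
  x + (b - a / 2) * v <= y + a / 2 * u.
Proof. by move=> h uv /ler_wpM2l/(_ _ _ uv); lra. Qed.

Let tail_bound (x y a b u v : R) : x + (b - a) * v <= y -> v <= u -> 0 <= a ->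
  x + b * v <= y + a * u.
Proof. by move=> h uv /ler_wpM2l/(_ _ _ uv); lra. Qed.

Let convexity_bound (A B D e a1 q s zm tm : R) : 0 <= tm <= 1 ->
  A <= B + e -> B <= D -> D <= tm * a1 + (1 - tm) * zm -> a1 <= q -> zm <= s ->
  A - (s + e) <= tm * (q - s).
Proof.
move=> /andP[tm0]; rewrite -subr_ge0 => tm1 AB BD Da aq zs.
have := ler_wpM2l tm0 aq; have := ler_wpM2l tm1 zs; lra.
Qed.

Let gap_base (s0 del a z : R) : 0 < del -> s0 + 3 * del <= a ->
  a <= z + del * 1 ^+ 2 / 2 -> s0 + del * 1 * (1 + 1) <= z.
Proof. lra. Qed.

Let gap_step (del tn s s' a z : R) : s' <= 2^-1 * s + (1 - 2^-1) * a ->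
  a <= z + del * tn ^+ 2 / 2 -> s + del * tn * (1 + tn) <= z ->
  s' + del * (tn / 2) * (1 + tn / 2) <= z.
Proof. lra. Qed.

Section simons.
Variables (E : set M) (S : M -> R) (W_ : nat -> M) (del : R).
Hypothesis E_solid : solid_space P E.
Hypothesis S_mono : forall V V', E V -> E V' -> (forall w, V w <= V' w) -> S V <= S V'.
Hypothesis S_convex : convex_on E S.
Hypothesis EW0 : E (W_ 0%N).
Hypothesis W_decr : forall n w, 0 <= W_ n.+1 w <= W_ n w.
Hypothesis W0_ge0 : forall w, 0 <= W_ 0%N w.
Hypothesis del_gt0 : 0 < del.
Hypothesis S_gap : forall n, S 0 + 3 * del <= S (W_ n).
Let sE := solid_subspace E_solid.

Let W_le m n w : (m <= n)%N -> W_ n w <= W_ m w.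
Proof.
move=> /subnK <-; elim: (n - m)%N => // k IH.
by rewrite addSn; apply: le_trans IH; case/andP: (W_decr (k + m)%N w).
Qed.

Let W_ge0 n w : 0 <= W_ n w.
Proof. by case: n => // n; case/andP: (W_decr n w). Qed.

Let EW n : E (W_ n).
Proof. by apply: (solid_between E_solid EW0) => w; rewrite W_ge0 W_le. Qed.

Let ED X Y : E X -> E Y -> E (X + Y). Proof. exact: vector_subspaceD. Qed.
Let EZ (a : R) X : E X -> E (a *: X). Proof. exact: vector_subspaceZ. Qed.

(* The slack is such that the gap [del t_n (1 + t_n)] below [S z] reproduces itself
   when [n] increases. *)
Let eps n : R := del * t n ^+ 2 / 2.

Let eps_gt0 n : 0 < eps n.
Proof. by rewrite divr_gt0// mulr_gt0// exprn_gt0. Qed.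

Let next_index : exists f : nat * (M * nat) -> nat, forall n z k, E z ->
  [/\ (n <= f (n, (z, k)))%N, (k <= f (n, (z, k)))%N &
   forall j, S (z + t n *: W_ (f (n, (z, k)))) <= S (z + t n *: W_ j) + eps n].
Proof.
suff /choice[f Hf] : forall p : nat * (M * nat), exists i, E p.2.1 ->
    [/\ (p.1 <= i)%N, (p.2.2 <= i)%N &
     forall j, S (p.2.1 + t p.1 *: W_ i) <= S (p.2.1 + t p.1 *: W_ j) + eps p.1].
  by exists f => n z k Ez; exact: (Hf (n, (z, k)) Ez).
move=> [n [z k]] /=; have [Ez|nEz] := pselect (E z); last by exists 0%N.
pose B := [set S (z + t n *: W_ j) | j in [set: nat]].
have tW j : E (z + t n *: W_ j) by apply: ED => //; exact: EZ.
have B_inf : has_inf B.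
  split; first by exists (S (z + t n *: W_ 0%N)), 0%N.
  exists (S z) => _ [j _ <-]; apply: S_mono => // w.
  by rewrite !mfE lerDl mulr_ge0// ltW.
have [_ [i _ <-] Bi] := inf_adherent (eps_gt0 n) B_inf.
exists (maxn i (maxn n k)) => _; split.
- by rewrite (leq_trans (leq_maxl n k))// leq_maxr.
- by rewrite (leq_trans (leq_maxr n k))// leq_maxr.
- move=> j; apply: (@le_trans _ _ (S (z + t n *: W_ i))).
    apply: S_mono => // w; rewrite !mfE lerD2l ler_wpM2l ?(ltW (t_gt0 n))//.
    exact/W_le/leq_maxl.
  apply: (le_trans (ltW Bi)); rewrite lerD2r; apply: ge_inf; first exact: B_inf.2.
  by exists j.
Qed.

(** Simons' argument: along [z = sum_n 2^(-n-1) W_(k_n)] the values of [S] at the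
    partial sums stay so far below [S z] that the tail after [n] terms, which is
    at most [2^(-n) W_(k_n)], has to account for a gap of [del 2^(-n)]. *)
Lemma simons_series : exists z : M, E z /\ forall n, exists zn k,
  [/\ E zn, (n <= k)%N, forall w, z w <= zn w + t n * W_ k w &
      S zn + del * t n <= S z].
Proof.
have [f Hf] := next_index.
pose st := fix st n : M * nat := if n is m.+1 then
    let z' := (st m).1 + t n *: W_ (st m).2 in (z', f (n, (z', (st m).2)))
  else (0, f (0%N, (0, 0%N))).
pose z_ n := (st n).1; pose k_ n := (st n).2.
have z0 : z_ 0%N = 0 by [].
have zS n : z_ n.+1 = z_ n + t n.+1 *: W_ (k_ n) by [].
have Ez n : E (z_ n).
  by elim: n => [|n IH]; [exact: sE.1|rewrite zS; apply: ED => //; exact: EZ].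
have kS n : k_ n.+1 = f (n.+1, (z_ n.+1, k_ n)) by [].
have k_ge n : (n <= k_ n)%N.
  by case: n => // n; rewrite kS; case: (Hf n.+1 _ (k_ n) (Ez n.+1)).
have k_mono n : (k_ n <= k_ n.+1)%N.
  by rewrite kS; case: (Hf n.+1 _ (k_ n) (Ez n.+1)).
have k_min n j : S (z_ n + t n *: W_ (k_ n)) <= S (z_ n + t n *: W_ j) + eps n.
  case: n => [|n]; first by case: (Hf 0%N _ 0%N sE.1).
  by rewrite kS; case: (Hf n.+1 _ (k_ n) (Ez n.+1)).
have k_le n p : (k_ n <= k_ (n + p)%N)%N.
  by elim: p => [|p IH]; rewrite ?addn0// addnS (leq_trans IH).
have zSE n w : z_ n.+1 w = z_ n w + t n / 2 * W_ (k_ n) w.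
  by rewrite zS -tS.
have z_up n p w : z_ (n + p)%N w <= z_ n w + (t n - t (n + p)%N) * W_ (k_ n) w.
  elim: p => [|p]; first by rewrite addn0 subrr mul0r addr0.
  by rewrite addnS zSE tS => IH; exact: (step_up IH (W_le w (k_le n p)) (ltW (t_gt0 _))).
have z_low n p w : z_ n w + (t n - t (n + p)%N) * W_ (k_ (n + p)%N) w <= z_ (n + p)%N w.
  elim: p => [|p]; first by rewrite addn0 subrr mul0r addr0.
  rewrite addnS zSE tS => IH; apply: (step_low IH (W_le w (k_mono (n + p)%N))).
  by rewrite subr_ge0 -tS /t -addnS exprD ler_piMr.
have z_nd w : nondecreasing_seq (fun n => z_ n w).
  apply/nondecreasing_seqP => n; rewrite zSE lerDl mulr_ge0// divr_ge0//.
  exact: ltW.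
have z_bound n w : z_ n w <= W_ 0%N w.
  have := z_up 0%N n w; rewrite add0n z0 mfE add0r => /le_trans; apply.
  apply: le_trans (W_le w (leq0n (k_ 0%N))).
  by rewrite ler_piMl// t0 lerBlDr lerDl ltW.
have z_cvg w : cvgn (fun n => z_ n w).
  apply: nondecreasing_is_cvgn => //.
  by exists (W_ 0%N w) => _ [n _ <-].
pose zl w := limn (fun n => z_ n w).
have mzl : measurable_fun setT zl.
  by apply: (@measurable_fun_cvg _ _ _ setT (fun n => z_ n)) => // w _; exact: z_cvg.
pose z : M := HB.pack zl (isMeasurableFun.Build _ _ _ _ zl mzl).
have zE w : z w = limn (fun n => z_ n w) by [].
have zn_le n w : z_ n w <= z w.
  by rewrite zE; exact: (nondecreasing_cvgn_le (z_nd w) (z_cvg w)).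
have z_le n w : z w <= z_ n w + t n * W_ (k_ n) w.
  rewrite zE; apply: limr_le; first exact: z_cvg.
  exists n => // m /= nm; rewrite -(subnKC nm); apply: (le_trans (z_up _ _ _)).
  by rewrite lerD2l ler_wpM2r// gerBl ltW.
have zn_ge0 n w : 0 <= z_ n w.
  by apply: le_trans (z_nd w _ _ (leq0n n)); rewrite z0.
have Ezl : E z.
  apply: (solid_between E_solid EW0) => w.
  rewrite (le_trans (zn_ge0 0%N w) (zn_le 0%N w)) zE /=.
  by apply: limr_le => //; exact: nearW.
have near_z n : S (z_ n + t n *: W_ (k_ n)) <= S z + eps n.
  rewrite -subr_le0.
  apply: (le0_of_vanishing (c := t n * (S (2 *: W_ 0%N) - S z))) => p.
  rewrite mulrA -exprD addnC.
  pose m := (n + p)%N.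
  have EzW n' (s : R) j : E (z_ n' + s *: W_ j) by apply: ED => //; exact: EZ.
  have tm01 : 0 <= t m <= 1 by rewrite (ltW (t_gt0 m)) t_le1.
  have h3 : S (z_ m + t m *: W_ 0%N) <=
      t m * S (z_ m + W_ 0%N) + (1 - t m) * S (z_ m).
    apply: le_trans (S_convex (ED (Ez m) EW0) (Ez m) tm01).
    rewrite le_eqVlt; apply/orP; left; apply/eqP; congr S.
    transitivity (t m *: (z_ m + W_ 0%N) + (1 - t m) *: (z_ m + 0)).
      by rewrite conv_translate scaler0 addr0.
    by rewrite addr0.
  apply: (convexity_bound tm01 (k_min n (k_ m)) _ h3).
  - apply: S_mono => // w; rewrite !mfE.
    exact: (tail_bound (z_low n p w) (W_le w (leq0n (k_ m))) (ltW (t_gt0 m))).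
  - apply: S_mono; [exact: ED|exact: EZ|move=> w].
    by rewrite !mfE mulr_natl mulr2n lerD2r.
  - exact: S_mono.
have gap n : S (z_ n) + del * t n * (1 + t n) <= S z.
  elim: n => [|n IH].
    apply: (gap_base del_gt0 (S_gap (k_ 0%N))).
    by have := near_z 0%N; rewrite z0 add0r scale1r.
  rewrite tS; apply: (gap_step _ (near_z n) IH).
  have EzW : E (z_ n + t n *: W_ (k_ n)) by apply: ED => //; exact: EZ.
  apply: le_trans (S_convex (Ez n) EzW half01).
  rewrite le_eqVlt; apply/orP; left; apply/eqP; congr S.
  transitivity (2^-1 *: (z_ n + 0) + (1 - 2^-1) *: (z_ n + t n *: W_ (k_ n))).
    rewrite conv_translate scaler0 add0r scalerA zS tS.
    by congr (_ + _ *: _); rewrite halfC mulrC.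
  by rewrite addr0.
exists z; split => // n; exists (z_ n), (k_ n); split => //.
apply: le_trans (gap n); rewrite lerD2l ler_peMr ?lerDl ?(ltW (t_gt0 n))//.
by rewrite mulr_ge0// ltW.
Qed.

End simons.

Section dual_supremum.
Variables (E : set M) (psi : M -> R).
Hypothesis E_solid : solid_space P E.
Hypothesis E_cst : contains_constants P E.
Hypothesis psi_mc : monotone_convex P E psi.
Hypothesis sup_attained : forall X, E X ->
  dual_sup P psi X \is a fin_num /\ dual_attained P psi X.
Let sE := solid_subspace E_solid.

Let S X : R := fine (dual_sup P psi X).

Let intgM X Z : E X -> dom psi Z -> P.-integrable setT (EFin \o (X \* Z)).
Proof. exact: dom_intgM. Qed.

Let S_attained X : E X -> exists2 Z, dom psi Z &
  S X = Ex (X \* Z) - alpha P psi Z.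
Proof.
move=> EX; have [_ [Z dZ val]] := sup_attained EX; exists Z => //.
by rewrite /S -val (dual_valueE E_solid E_cst psi_mc).
Qed.

Let S_ge X Z : E X -> dom psi Z -> Ex (X \* Z) - alpha P psi Z <= S X.
Proof.
move=> EX dZ; have [Xfin _] := sup_attained EX.
rewrite -lee_fin /S fineK// -(dual_valueE E_solid E_cst psi_mc)//.
by apply: ereal_sup_ubound; exists Z.
Qed.

Let S_mono V V' : E V -> E V' -> (forall w, V w <= V' w) -> S V <= S V'.
Proof.
move=> EV EV' VV'; have [Z dZ ->] := S_attained EV.
apply: le_trans (S_ge EV' dZ); rewrite lerD2r.
by apply: (le_ExM E_solid E_cst psi_mc) => //; exact: aeW.
Qed.

Let affine_comb (r x y a : R) :
  r * x + (1 - r) * y - a = r * (x - a) + (1 - r) * (y - a).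
Proof. ring. Qed.

Let S_convex : convex_on E S.
Proof.
move=> V V' r EV EV' /andP[r0]; rewrite -subr_ge0 => r1.
have [|Z dZ ->] := @S_attained (r *: V + (1 - r) *: V'); first exact: sE.2.
have [_ ->] := intgM_comb r (1 - r) (intgM EV dZ) (intgM EV' dZ).
by rewrite affine_comb lerD// ler_wpM2l//; exact: S_ge.
Qed.

Let gap_bound (m zn z w s sn s' al : R) : 0 < m -> z <= zn + m * w ->
  s = z - al -> zn - al <= sn -> sn + s' * m <= s -> s' <= w.
Proof.
move=> m0 zw -> znal sns; rewrite -(ler_pM2r m0) [w * m]mulrC; lra.
Qed.

(* If [S (W_n)] does not fall to [S 0], a [Z] maximizing at the sum of the series of
   [simons_series] accounts for its gaps, so that [E[W_k Z]] does not vanish. *)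
Let S_continuous (W_ : nat -> M) : E (W_ 0%N) ->
  (forall n w, 0 <= W_ n.+1 w <= W_ n w) -> (forall w, 0 <= W_ 0%N w) ->
  (\forall w \ae P, W_ n w @[n --> \oo] --> 0) ->
  exists N, S (W_ N) <= S 0 + 1.
Proof.
move=> EW Wd W0 Wc; apply: contrapT => /forallNP SW.
pose del : R := 3^-1.
have del0 : 0 < del by rewrite invr_gt0.
have gap n : S 0 + 3 * del <= S (W_ n).
  by rewrite /del divff// ltW// ltNge; apply/negP; exact: SW.
have [z [Ez Hz]] := simons_series E_solid S_mono S_convex EW Wd W0 del0 gap.
have [Z dZ Sz] := S_attained Ez.
have Wge0 n w : 0 <= W_ n w by case: n => // n; case/andP: (Wd n w).
have Wle n w : W_ n w <= W_ 0%N w.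
  by elim: n => // n; apply: le_trans; case/andP: (Wd n w).
have EWn n : E (W_ n) by apply: (solid_between E_solid EW) => w; rewrite Wge0 Wle.
have : Ex (W_ n \* Z) @[n --> \oo] --> 0.
  apply: (ExM_cvg0 E_solid E_cst psi_mc EW) => // n.
  by apply: aeW => w; rewrite ger0_norm.
have del20 : 0 < del / 2 by rewrite divr_gt0.
move=> /(cvg_seqP _ _).1/(_ _ del20)[N HN].
have [zn [k [Ezn Nk zle Szn]]] := Hz N.
have : del <= Ex (W_ k \* Z).
  apply: (gap_bound (t_gt0 N) _ Sz (S_ge Ezn dZ) Szn).
  rewrite -ExZ; last exact: intgM.
  have EtW : E (t N *: W_ k) by exact: vector_subspaceZ.
  have -> : (fun w => t N * (W_ k \* Z) w) = (t N *: W_ k : M) \* Z.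
    by apply/funext => w; exact: mulrA.
  have [_ EzW] := intgM_comb 1 1 (intgM Ezn dZ) (intgM EtW dZ).
  rewrite !mul1r in EzW; rewrite -EzW !scale1r.
  apply: (le_ExM E_solid E_cst psi_mc) => //; first exact: vector_subspaceD.
  by apply: aeW => w; rewrite !mfE.
have := HN k Nk; rewrite subr0 => /(le_trans (ler_norm _)) h /le_trans/(_ h).
by rewrite leNgt ltr_pdivrMr// ltr_pMr// ltr1n.
Qed.

Lemma attained_uniformly_integrable X (c : R) : E X ->
  uniformly_integrable P (sublevel_products P psi X c).
Proof.
move=> EX; apply: (sublevel_uniformly_integrable E_solid E_cst psi_mc (F := S)
  (C := S 0)) => // V Z EV _ dZ.
by rewrite -lerBlDr; exact: S_ge.
Qed.

End dual_supremum.
End attained_suprema.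

(** * The equivalence *)

Theorem theorem3p9 (R : realType) (d : measure_display) (T : measurableType d)
    (P : probability T R) (E : set {RV P >-> R}) (psi : {RV P >-> R} -> R)
    (E_solid : solid_space P E) (E_cst : contains_constants P E)
    (psi_mc : monotone_convex P E psi) (psi_fatou : fatou_property P E psi) :
  [<-> lebesgue_property P E psi;
       forall (X : {RV P >-> R}) (c : R), E X -> 0 < c ->
         uniformly_integrable P
           [set X \* Z | Z in [set Z : {RV P >-> R} |
                                L1 P Z /\ (conj_Loo P psi Z <= c%:E)%E]];
       forall X : {RV P >-> R}, E X ->
         dual_sup P psi X \is a fin_num /\ dual_attained P psi X;
       forall X : {RV P >-> R}, E X ->
         (psi X)%:E = dual_sup P psi X /\ dual_attained P psi X].
Proof.
have ui_leb := uniformly_integrable_lebesgue E_solid E_cst psi_mc psi_fatou.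
have leb_max := lebesgue_dual_attained E_solid E_cst psi_mc.
have max_att (H : forall X : {RV P >-> R}, E X ->
    (psi X)%:E = dual_sup P psi X /\ dual_attained P psi X) (X : {RV P >-> R}) :
    E X -> dual_sup P psi X \is a fin_num /\ dual_attained P psi X.
  by move=> /H[<-].
have att_leb (H : forall X : {RV P >-> R}, E X ->
    dual_sup P psi X \is a fin_num /\ dual_attained P psi X) :
    lebesgue_property P E psi.
  apply: ui_leb => X c EX _.
  exact: (attained_uniformly_integrable E_solid E_cst psi_mc H c EX).
tfae.
- move=> leb X c EX _.
  exact: (lebesgue_uniformly_integrable E_solid E_cst psi_mc leb c EX).
- by move=> /ui_leb/leb_max/max_att.
- by move=> /att_leb/leb_max.
- by move=> /max_att/att_leb.
Qed.
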